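(* Let $w=t_\lambda\bar w\in\mathrm{Adm}_{G_r}(\mu)$. Given a reflection ordering $\prec$ on $W_{\mathrm{aff}}$, let $\prec$ also denote its restriction to $W$. There is an explicit $\prec$-preserving bijection between $B_{\Phi_{\mathrm{aff}}}(w,t_\lambda)$, whose paths go through the Bruhat graph $\Omega_{(W_{\mathrm{aff}},S_{\mathrm{aff}})}$, and $B_\Phi(w_\lambda^{-1}\bar w,w_\lambda^{-1})$, whose paths go through the Bruhat graph $\Omega_{(W,S)}$.
   Context: $G$ is a split connected reductive group over a non-archimedean local field $F$ with split maximal torus $T$, Borel $B\supset T$, root system $\Phi=\Phi(G,T)$ with positive roots $\Phi^+$, and finite Weyl group $(W,S)$; $G_r=G(F_r)$ for the degree $r$ unramified extension $F_r/F$. Standing assumptions: $G$ has connected center and simply connected derived group, and for every depth-zero character $\chi$ of $T(\mathcal O_F)$ (a smooth character factoring through the points of $T$ over the residue field of the ring of integers $\mathcal O_F$ of $F$) the stabilizer of $\chi$ in $W$ is generated by the reflections $s_\alpha$ with $\alpha\in\Phi$, $\chi\circ\alpha^\vee|_{\mathcal O_F^\times}=1$. $\widetilde W=X_*(T)\rtimes W=W_{\mathrm{aff}}\rtimes\Omega$ is the extended affine Weyl group, where $(W_{\mathrm{aff}},S_{\mathrm{aff}})$ is generated by reflections in the walls of the base alcove (in the $B$-positive chamber, origin in its closure) and $\Omega$ is the stabilizer of this alcove. Length and Bruhat order extend to $\widetilde W$: elements of $\Omega$ have length $0$, and $\sigma u\le\sigma'u'$ iff $\sigma=\sigma'$ and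 $u\le u'$ ($\sigma,\sigma'\in\Omega$, $u,u'\in W_{\mathrm{aff}}$). $\mu\in X_*(T)$ is dominant and minuscule ($\langle\mu,\alpha\rangle\in\{-1,0,1\}$ for $\alpha\in\Phi$), and $\mathrm{Adm}_{G_r}(\mu)=\{w\in\widetilde W:w\le t_\eta\text{ for some }\eta\in W\mu\}$. Each $w\in\widetilde W$ is written $w=t_\lambda\bar w$ with $\lambda\in X_*(T)$, $\bar w\in W$, $t_\lambda$ being translation by $\lambda$; $w_\lambda\in W$ is the unique element such that $t_\lambda w_\lambda$ has minimal length in the coset $t_\lambda W$. The Bruhat graph $\Omega_{(\mathcal W,\mathcal S)}$ of a Coxeter system has directed edges $u\to ut$ for reflections $t$ with $\ell(u)<\ell(ut)$. For a path $\Delta: u=u_0\to u_1\to\dots\to u_n=v$ the edges are the reflections $t_i=u_{i-1}^{-1}u_i$. $B_\Phi(u,v)$ is the set of all paths from $u$ to $v$ in $\Omega_{(W,S)}$; $B_{\Phi_{\mathrm{aff}}}(w,t_\lambda)$ is the set of all paths from $\sigma^{-1}w$ to $\sigma^{-1}t_\lambda$ in $\Omega_{(W_{\mathrm{aff}},S_{\mathrm{aff}})}$, where $\sigma\in\Omega$ satisfies $w,t_\lambda\in\sigma W_{\mathrm{aff}}$ (equivalently sequences $w<wt_1<\dots<wt_1\cdots t_n=t_\lambda$ with $t_i$ reflections in $W_{\mathrm{aff}}$). A reflection ordering on a Coxeter group is a total order $\prec$ on its positive roots (equivalently, on its reflections) such that whenever $\alpha,\beta,a\alpha+b\beta$ are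 positive roots with $a,b>0$ real, either $\alpha\prec a\alpha+b\beta\prec\beta$ or $\beta\prec a\alpha+b\beta\prec\alpha$. The explicit bijection sends a path $w<wt_1<wt_1t_2<\dots<wt_1\cdots t_n=t_\lambda$ to the path $w_\lambda^{-1}\bar w<w_\lambda^{-1}\bar wt_1<\dots<w_\lambda^{-1}\bar wt_1\cdots t_n=w_\lambda^{-1}$ (the $t_i$ being reflections in $W$). That it is $\prec$-preserving means that corresponding paths have identical edges $t_1,\dots,t_n$, appearing in the same order; in particular $\prec$-increasing paths (those with $t_1\prec\dots\prec t_n$) correspond to $\prec$-increasing paths. *)

(* Defs.v *)
From mathcomp Require Export all_boot all_order all_algebra.
From mathcomp Require Export all_classical all_reals.
From mathcomp Require Export complex.

Set Implicit Arguments.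
Unset Strict Implicit.
Unset Printing Implicit Defensive.

Import Order.TTheory GRing.Theory Num.Theory.

Local Open Scope classical_set_scope.
Local Open Scope ring_scope.

(** * Affine transformations of the cocharacter lattice *)

(* A basis of X_*(T) identifies X_*(T) with column vectors and X^*(T) with row
   vectors over the integers.  The pair (l, A) is the affine map
   x |-> l + A *m x; matrices acting on X_*(T) act from the left. *)
Notation aff n := ('cV[int]_n * 'M[int]_n)%type.

Definition amul n (g h : aff n) : aff n := (g.1 + g.2 *m h.1, g.2 *m h.2).
Definition aone n : aff n := (0, 1%:M).
(* The inverse of g whenever g.2 is invertible over the integers. *)
Definition ainv n (g : aff n) : aff n :=
  (- (invmx g.2 *m g.1), invmx g.2).

Notation "g ** h" := (amul g h) (at level 40, left associativity).

Definition tr n (l : 'cV[int]_n) : aff n := (l, 1%:M).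

Definition aprod n (s : seq (aff n)) : aff n := foldr (@amul n) (aone n) s.

(** * Coxeter groups given by a set [S] of involutive generators *)

(* Words in [S] suffice to generate a group, as [S] consists of involutions. *)
Definition generated n (S : set (aff n)) : set (aff n) :=
  [set g | exists2 s : seq (aff n), (forall x, x \in s -> S x) & aprod s = g].

Definition has_length n (S : set (aff n)) (g : aff n) (m : nat) : Prop :=
  (exists s : seq (aff n),
     [/\ forall x, x \in s -> S x, aprod s = g & size s = m]) /\
  (forall s : seq (aff n),
     (forall x, x \in s -> S x) -> aprod s = g -> (m <= size s)%N).

Definition reflections n (S : set (aff n)) : set (aff n) :=
  [set t | exists u s, [/\ generated S u, S s & t = u ** s ** ainv u]].

Definition bruhat_edge n (S : set (aff n)) (u v : aff n) : Prop :=
  generated S u /\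
  exists t, [/\ reflections S t, v = u ** t &
    exists m k, [/\ has_length S u m, has_length S v k & (m < k)%N]].

Fixpoint bruhat_chain n (S : set (aff n)) (u : aff n) (q : seq (aff n)) : Prop :=
  if q is v :: q' then bruhat_edge S u v /\ bruhat_chain S v q' else True.

(* A path is the sequence [:: u_0; ...; u_n] of all its vertices. *)
Definition bruhat_paths n (S : set (aff n)) (u v : aff n) :
    set (seq (aff n)) :=
  [set p | exists q, [/\ p = u :: q, generated S u, bruhat_chain S u q
                       & last u q = v]].

Definition bruhat_le n (S : set (aff n)) (u v : aff n) : Prop :=
  exists p, bruhat_paths S u v p.

(* The sequence of the t_i = u_{i-1}^-1 u_i. *)
Definition edges n (p : seq (aff n)) : seq (aff n) :=
  if p is u :: q then pairmap (fun x y => ainv x ** y) u q else [::].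

(* The sequence u, u t_1, u t_1 t_2, ... for t_1, t_2, ... the edges of p. *)
Definition transport n (u : aff n) (p : seq (aff n)) : seq (aff n) :=
  u :: scanl (@amul n) u (edges p).

(** * Root data *)

Definition pairing n (a : 'rV[int]_n) (l : 'cV[int]_n) : int := (a *m l) 0 0.

(* Reduced root data, with the roots and the coroots indexed by a finite type
   which realizes the bijection between roots and coroots.  They classify the
   pairs (G, T) with G split connected reductive and T a split maximal torus
   over a given field. *)
Record root_datum (n : nat) := RootDatum {
  rindex :> finType;
  rt : rindex -> 'rV[int]_n;
  crt : rindex -> 'cV[int]_n;
  rt_inj : injective rt;
  crt_inj : injective crt;
  rt_crt : forall a, pairing (rt a) (crt a) = 2;
  rt_stable : forall a b,
    exists c, rt c = rt b - pairing (rt b) (crt a) *: rt a;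
  crt_stable : forall a b,
    exists c, crt c = crt b - pairing (rt a) (crt b) *: crt a;
  rt_reduced : forall a b, rt b <> 2 *: rt a
}.

(* The positive systems, i.e. the sets of roots of the Borel subgroups
   containing T, are cut out by the regular cocharacters. *)
Definition positive_system n (D : root_datum n) (pos : pred D) : Prop :=
  exists x : 'cV[int]_n,
    forall a, pairing (rt a) x != 0 /\ pos a = (0 < pairing (rt a) x).

Definition simple_root n (D : root_datum n) (pos : pred D) (a : D) : Prop :=
  pos a /\ ~ (exists b c, [/\ pos b, pos c & rt a = rt b + rt c]).

(* s_a on X_*(T), i.e. l |-> l - <a, l> a^vee. *)
Definition srefl n (D : root_datum n) (a : D) : 'M[int]_n :=
  1%:M - crt a *m rt a.

Definition finrefl n (D : root_datum n) (a : D) : aff n := (0, srefl a).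

Definition weyl n (D : root_datum n) : set (aff n) :=
  generated [set g | exists a : D, g = finrefl a].

Definition simple_refl n (D : root_datum n) (pos : pred D) : set (aff n) :=
  [set g | exists2 a, simple_root pos a & g = finrefl a].

Definition ext_weyl n (D : root_datum n) : set (aff n) :=
  [set g | exists l w, weyl D w /\ g = tr l ** w].

Definition in_span (I : finType) p q (e : I -> 'M[int]_(p, q))
    (x : 'M[int]_(p, q)) : Prop :=
  exists c : I -> int, x = \sum_i c i *: e i.

(** * The base alcove and the affine Weyl group *)

Definition rpairing (R : realType) n (D : root_datum n) (a : D)
    (x : 'cV[R]_n) : R :=
  (map_mx intr (rt a) *m x) 0 0.

(* The affine root (a, k) is the function x |-> <a, x> + k on X_*(T) (x) R. *)
Definition aroot n (D : root_datum n) : Type := (rindex D * int)%type.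

Definition aeval (R : realType) n (D : root_datum n) (c : aroot D)
    (x : 'cV[R]_n) : R :=
  rpairing c.1 x + c.2%:~R.

(* The reflection x |-> x - (<a, x> + k) a^vee in its zero set. *)
Definition arefl n (D : root_datum n) (c : aroot D) : aff n :=
  (- c.2 *: crt c.1, srefl c.1).

Definition act (R : realType) n (g : aff n) (x : 'cV[R]_n) : 'cV[R]_n :=
  map_mx intr g.1 + map_mx intr g.2 *m x.

Definition alcove (R : realType) n (D : root_datum n) (pos : pred D) :
    set 'cV[R]_n :=
  [set x | forall a, pos a -> 0 < rpairing a x < 1].

Definition closed_alcove (R : realType) n (D : root_datum n) (pos : pred D) :
    set 'cV[R]_n :=
  [set x | forall a, pos a -> 0 <= rpairing a x <= 1].

Definition on_hyperplane (R : realType) n (D : root_datum n) (c : aroot D) :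
    set 'cV[R]_n :=
  [set x | aeval c x = 0].

(* A wall supports a facet of codimension one: some point of the closed alcove
   lies on this affine root hyperplane and on no other one. *)
Definition wall (R : realType) n (D : root_datum n) (pos : pred D)
    (c : aroot D) : Prop :=
  exists x : 'cV[R]_n,
    [/\ @closed_alcove R n D pos x, on_hyperplane c x &
      forall d : aroot D, on_hyperplane d x ->
        @on_hyperplane R n D d = @on_hyperplane R n D c].

Definition aff_simple_refl (R : realType) n (D : root_datum n)
    (pos : pred D) : set (aff n) :=
  [set g | exists2 c, @wall R n D pos c & g = arefl c].

Definition aff_weyl (R : realType) n (D : root_datum n) (pos : pred D) :
    set (aff n) :=
  generated (@aff_simple_refl R n D pos).

Definition omega (R : realType) n (D : root_datum n) (pos : pred D) :
    set (aff n) :=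
  [set g | ext_weyl D g /\
           @act R n g @` @alcove R n D pos = @alcove R n D pos].

(** * Length and Bruhat order on the extended affine Weyl group *)

Definition ext_has_length (R : realType) n (D : root_datum n) (pos : pred D)
    (g : aff n) (m : nat) : Prop :=
  exists s u, [/\ omega R pos s, aff_weyl R pos u, g = s ** u
                & has_length (aff_simple_refl R pos) u m].

Definition ext_le (R : realType) n (D : root_datum n) (pos : pred D)
    (g h : aff n) : Prop :=
  exists s u v, [/\ omega R pos s, aff_weyl R pos u /\ aff_weyl R pos v,
    g = s ** u, h = s ** v & bruhat_le (aff_simple_refl R pos) u v].

Definition admissible (R : realType) n (D : root_datum n) (pos : pred D)
    (mu : 'cV[int]_n) : set (aff n) :=
  [set w | ext_weyl D w /\
           exists2 v, weyl D v & ext_le R pos w (tr (v.2 *m mu))].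

(* [wl] is the element w_l of the finite Weyl group. *)
Definition is_min_rep (R : realType) n (D : root_datum n) (pos : pred D)
    (l : 'cV[int]_n) (wl : aff n) : Prop :=
  weyl D wl /\
  exists2 m, ext_has_length R pos (tr l ** wl) m &
    forall v k, weyl D v -> ext_has_length R pos (tr l ** v) k -> (m <= k)%N.

(* The paths from w to v, both lying in s W_aff with s in Omega, shifted by
   s^-1 to paths in the Bruhat graph of W_aff. *)
Definition aff_bruhat_paths (R : realType) n (D : root_datum n)
    (pos : pred D) (w v : aff n) : set (seq (aff n)) :=
  [set p | exists s, [/\ omega R pos s,
     aff_weyl R pos (ainv s ** w), aff_weyl R pos (ainv s ** v) &
     bruhat_paths (aff_simple_refl R pos) (ainv s ** w) (ainv s ** v) p]].

(** * Reflection orderings *)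

(* Positive affine roots are those positive on the base alcove.  Up to positive
   scalars, which are irrelevant for the orderings below, they are the positive
   roots of the Coxeter group W_aff. *)
Definition apositive (R : realType) n (D : root_datum n) (pos : pred D)
    (c : aroot D) : Prop :=
  forall x : 'cV[R]_n, @alcove R n D pos x -> 0 < aeval c x.

Definition reflection_ordering (R : realType) n (D : root_datum n)
    (pos : pred D) (prec : rel (aff n)) : Prop :=
  let T := reflections (aff_simple_refl R pos) in
  [/\ forall t, T t -> ~~ prec t t,
      forall t1 t2 t3, T t1 -> T t2 -> T t3 ->
        prec t1 t2 -> prec t2 t3 -> prec t1 t3,
      forall t1 t2, T t1 -> T t2 -> t1 <> t2 -> prec t1 t2 \/ prec t2 t1 &
      forall (b c d : aroot D) (x y : R),
        apositive R pos b -> apositive R pos c -> apositive R pos d ->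
        b <> c -> 0 < x -> 0 < y ->
        (forall z : 'cV[R]_n, aeval d z = x * aeval b z + y * aeval c z) ->
        (prec (arefl b) (arefl d) /\ prec (arefl d) (arefl c)) \/
        (prec (arefl c) (arefl d) /\ prec (arefl d) (arefl b))].

Definition restrict_order n (S : set (aff n)) (prec : rel (aff n)) :
    rel (aff n) :=
  fun t t' => [&& t \in reflections S, t' \in reflections S & prec t t'].

(** * Non-archimedean local fields and depth-zero characters *)

Definition val_ge (F : fieldType) (v : F -> int) (k : int) (x : F) : Prop :=
  x = 0 \/ k <= v x.

(* [v] is the normalized valuation of the local field [F]; [v 0] is
   irrelevant. *)
Definition local_field (F : fieldType) (v : F -> int) : Prop :=
  [/\ forall x y, x != 0 -> y != 0 -> v (x * y) = v x + v y,
      forall k x y, val_ge v k x -> val_ge v k y -> val_ge v k (x + y),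
      exists2 x, x != 0 & v x = 1,
      forall u : nat -> F,
        (forall k, exists N, forall i j, (N <= i)%N -> (N <= j)%N ->
           val_ge v k (u i - u j)) ->
        exists l, forall k, exists N, forall i, (N <= i)%N ->
           val_ge v k (u i - l) &
      exists s : seq F, forall x, val_ge v 0 x ->
        exists2 y, y \in s & val_ge v 1 (x - y)].

Definition integer_unit (F : fieldType) (v : F -> int) (x : F) : Prop :=
  x != 0 /\ v x = 0.

(* T(O_F), identified with n-tuples of units of O_F by the basis of X_*(T). *)
Definition torus_points (F : fieldType) (v : F -> int) n : set 'cV[F]_n :=
  [set t | forall i, integer_unit v (t i 0)].

Definition torus_mul (F : fieldType) n (t t' : 'cV[F]_n) : 'cV[F]_n :=
  \col_i (t i 0 * t' i 0).

Definition cochar (F : fieldType) n (l : 'cV[int]_n) (x : F) : 'cV[F]_n :=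
  \col_i (x ^ l i 0).

Definition weyl_act (F : fieldType) n (w : 'M[int]_n) (t : 'cV[F]_n) :
    'cV[F]_n :=
  \col_i \prod_j (t j 0 ^ w i j).

(* A character of T(O_F) factors through the points of T over the residue field
   iff it is trivial on the kernel of reduction.  Such a character is smooth;
   its values outside T(O_F) are irrelevant. *)
Definition depth_zero_character (R : realType) (F : fieldType) (v : F -> int) n
    (chi : 'cV[F]_n -> R[i]) : Prop :=
  (forall t t', torus_points v t -> torus_points v t' ->
     chi (torus_mul t t') = chi t * chi t') /\
  (forall t, torus_points v t -> (forall i, val_ge v 1 (t i 0 - 1)) ->
     chi t = 1).

Definition char_stabilizer (R : realType) (F : fieldType) (v : F -> int) n
    (D : root_datum n) (chi : 'cV[F]_n -> R[i]) : set (aff n) :=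
  [set w | weyl D w /\ forall t, torus_points v t ->
             chi (weyl_act (invmx w.2) t) = chi t].

Definition stabilizers_generated (R : realType) (F : fieldType) (v : F -> int)
    n (D : root_datum n) : Prop :=
  forall chi : 'cV[F]_n -> R[i], depth_zero_character v chi ->
    char_stabilizer v D chi =
    generated [set g | exists a : D, g = finrefl a /\
      forall x, integer_unit v x -> chi (cochar (crt a) x) = 1].

(* The center is the diagonalizable F-group with character group X^*(T)/Z Phi,
   connected iff this group has no torsion of order prime to the
   characteristic of F. *)
Definition connected_center (F : fieldType) n (D : root_datum n) : Prop :=
  forall (m : nat) (x : 'rV[int]_n), m%:R != 0 :> F ->
    in_span (@rt n D) (x *+ m) -> in_span (@rt n D) x.

(* X_*(T)/Z Phi^vee is torsion-free. *)
Definition simply_connected_derived n (D : root_datum n) : Prop :=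
  forall (m : nat) (x : 'cV[int]_n), m != 0%N ->
    in_span (@crt n D) (x *+ m) -> in_span (@crt n D) x.

Definition dominant n (D : root_datum n) (pos : pred D) (mu : 'cV[int]_n) :
    Prop :=
  forall a, pos a -> 0 <= pairing (rt a) mu.

Definition minuscule n (D : root_datum n) (mu : 'cV[int]_n) : Prop :=
  forall a : D, pairing (rt a) mu \in [:: -1; 0; 1].

(* Main.v *)
(* Right multiplication by a reflection [t = s_c], with [c] a positive affine
   root, increases the length of [x] iff the affine root [x(c)] is positive;
   this is a form of the exchange condition and holds for [W] and [W_aff] alike.

   Let [l = x(0)] be the image of the origin.  Going down an edge, minuscularity
   of [l] is preserved, and [l] either stays fixed or is increased by a positive
   coroot.  Hence [lambda] is minuscule, as [w] lies below some [t_eta], and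
   every vertex of a path from [w] to [t_lambda] has image [lambda], i.e. is of
   the form [t_lambda u] with [u] in [W], so that its edges are reflections of
   [W].  Finally, for a root [a], the affine root [t_lambda u (a)] is positive
   iff the root [w_lambda^-1 u (a)] is, because [t_lambda w_lambda] has minimal
   length in its coset.  So left multiplication by [(t_lambda w_lambda)^-1]
   identifies the two sets of paths. *)

Require Import Defs.
From mathcomp Require Import zify ring lra.

Set Implicit Arguments.
Unset Strict Implicit.
Unset Printing Implicit Defensive.

Import Order.TTheory GRing.Theory Num.Theory.

Local Open Scope classical_set_scope.
Local Open Scope ring_scope.

(** * Affine maps *)

Section Affine.
Variable n : nat.
Implicit Types (g h : aff n) (a b : 'rV[int]_n) (l : 'cV[int]_n).

Lemma amulA g h k : g ** (h ** k) = g ** h ** k.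
Proof. by rewrite /amul /= mulmxDr !mulmxA addrA. Qed.

Lemma amul1g g : aone n ** g = g.
Proof. by case: g => x M; rewrite /amul /= !mul1mx add0r. Qed.

Lemma amulg1 g : g ** aone n = g.
Proof. by case: g => x M; rewrite /amul /= mulmx1 mulmx0 addr0. Qed.

Lemma amulgV g : g.2 \in unitmx -> g ** ainv g = aone n.
Proof. by move=> ug; rewrite /amul /= mulmxN mulKVmx // mulmxV // subrr. Qed.

Lemma amulVg g : g.2 \in unitmx -> ainv g ** g = aone n.
Proof. by move=> ug; rewrite /amul /= mulVmx // addNr. Qed.

Lemma amulKg g h : g.2 \in unitmx -> ainv g ** (g ** h) = h.
Proof. by move=> ug; rewrite amulA amulVg // amul1g. Qed.

Lemma amulKVg g h : g.2 \in unitmx -> g ** (ainv g ** h) = h.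
Proof. by move=> ug; rewrite amulA amulgV // amul1g. Qed.

Lemma amulgK g h : h.2 \in unitmx -> g ** h ** ainv h = g.
Proof. by move=> uh; rewrite -amulA amulgV // amulg1. Qed.

Lemma ainv_unit g : ((ainv g).2 \in unitmx) = (g.2 \in unitmx).
Proof. by rewrite unitmx_inv. Qed.

Lemma ainvK g : g.2 \in unitmx -> ainv (ainv g) = g.
Proof.
move=> ug; case: g ug => x M /= ug.
by rewrite /ainv /= invmxK mulmxN opprK mulKVmx.
Qed.

Lemma ainv_uniq g h : g.2 \in unitmx -> g ** h = aone n -> ainv g = h.
Proof. by move=> ug gh; rewrite -(amulKg h ug) gh amulg1. Qed.

Lemma ainvM g h : g.2 \in unitmx -> h.2 \in unitmx ->
  ainv (g ** h) = ainv h ** ainv g.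
Proof.
move=> ug uh; apply: ainv_uniq; first by rewrite unitmx_mul ug.
by rewrite -amulA (amulA h) amulgV // amul1g amulgV.
Qed.

Lemma aprod_cat (s r : seq (aff n)) : aprod (s ++ r) = aprod s ** aprod r.
Proof. by elim: s => [|x s IHs] /=; rewrite ?amul1g // IHs amulA. Qed.

Lemma aprod_rcons (s : seq (aff n)) x : aprod (rcons s x) = aprod s ** x.
Proof. by rewrite -cats1 aprod_cat /= amulg1. Qed.

Lemma generated1 (S : set (aff n)) : generated S (aone n).
Proof. by exists [::]. Qed.

Lemma generatedM (S : set (aff n)) g h :
  generated S g -> generated S h -> generated S (g ** h).
Proof.
move=> [s sS <-] [r rS <-]; exists (s ++ r); last exact: aprod_cat.
by move=> x; rewrite mem_cat => /orP[/sS|/rS].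
Qed.

Lemma generated_gen (S : set (aff n)) g : S g -> generated S g.
Proof. by move=> Sg; exists [:: g]; rewrite /= ?amulg1 // => x;
  rewrite inE => /eqP->. Qed.

Lemma generated_le (S T : set (aff n)) :
  (forall g, S g -> generated T g) -> generated S `<=` generated T.
Proof.
move=> ST _ [s sS <-]; elim: s sS => [|x s IHs] sS; first exact: generated1.
apply: generatedM; first by apply/ST/sS; rewrite mem_head.
by apply: IHs => y ys; apply: sS; rewrite inE ys orbT.
Qed.

Lemma generatedV (S : set (aff n)) :
  (forall g, S g -> g.2 \in unitmx /\ g ** g = aone n) ->
  forall g, generated S g -> g.2 \in unitmx /\ generated S (ainv g).
Proof.
move=> invS _ [s sS <-]; elim: s sS => [|x s IHs] sS /=.
  split; first exact: unitmx1.
  by rewrite (@ainv_uniq _ (aone n)) ?unitmx1 ?amulg1 //; apply: generated1.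
have [ux xx] : _ /\ _ := invS x (sS x (mem_head _ _)).
have [|us gs] := IHs; first by move=> y ys; apply: sS; rewrite inE ys orbT.
split; first by rewrite unitmx_mul ux.
rewrite ainvM // (ainv_uniq ux xx); apply: generatedM => //.
by apply: generated_gen; apply: sS; rewrite mem_head.
Qed.

Lemma has_length_ex (S : set (aff n)) g :
  generated S g -> exists m, has_length S g m.
Proof.
move=> [s sS sg].
pose P m := `[< exists s : seq (aff n),
     [/\ forall x, x \in s -> S x, aprod s = g & size s = m] >].
have exP : exists m, P m by exists (size s); apply/asboolP; exists s.
exists (ex_minn exP); case: ex_minnP => m /asboolP Pm minm; split=> // r rS rg.
by apply: minm; apply/asboolP; exists r.
Qed.

Lemma pairingDl a b l : pairing (a + b) l = pairing a l + pairing b l.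
Proof. by rewrite /pairing mulmxDl mxE. Qed.
Lemma pairingDr a l (m : 'cV[int]_n) : pairing a (l + m) =
  pairing a l + pairing a m.
Proof. by rewrite /pairing mulmxDr mxE. Qed.
Lemma pairingNl a l : pairing (- a) l = - pairing a l.
Proof. by rewrite /pairing mulNmx mxE. Qed.
Lemma pairingNr a l : pairing a (- l) = - pairing a l.
Proof. by rewrite /pairing mulmxN mxE. Qed.
Lemma pairingZl c a l : pairing (c *: a) l = c * pairing a l.
Proof. by rewrite /pairing -scalemxAl mxE. Qed.
Lemma pairingZr c a l : pairing a (c *: l) = c * pairing a l.
Proof. by rewrite /pairing -scalemxAr mxE. Qed.
Lemma pairing0l l : pairing 0 l = 0.
Proof. by rewrite /pairing mul0mx mxE. Qed.
Lemma pairing_mul a (M : 'M_n) l : pairing (a *m M) l = pairing a (M *m l).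
Proof. by rewrite /pairing mulmxA. Qed.
Definition pairingE := (pairingDl, pairingDr, pairingNl, pairingNr,
  pairingZl, pairingZr).

Lemma mulmx_pairing (a : 'rV[int]_n) (l : 'cV[int]_n) (m : 'cV[int]_n) :
  m *m a *m l = pairing a l *: m.
Proof.
rewrite -mulmxA (mx11_scalar (a *m l)) -/(pairing a l).
by rewrite mul_mx_scalar.
Qed.

Lemma pairing_mulmx (a b : 'rV[int]_n) (l : 'cV[int]_n) :
  a *m (l *m b) = pairing a l *: b.
Proof.
by rewrite mulmxA (mx11_scalar (a *m l)) -/(pairing a l) mul_scalar_mx.
Qed.

End Affine.

(** * Roots *)

(** With a nonzero step, [k |-> u + k v] would be injective and embed too many integers into a
    finite type. *)
Lemma finite_progression (I : finType) p q (e : I -> 'M[int]_(p, q))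
    (u v : 'M[int]_(p, q)) :
  (forall k : nat, exists i, e i = u + v *+ k) -> v = 0.
Proof.
move=> /choice[f fE]; apply: contrapT => /eqP v0.
suff injf : injective f.
  have := leq_card (fun k : 'I_#|I|.+1 => f k).
  rewrite card_ord ltnn => /(_ _)/negP; apply; rewrite //.
  by move=> x y /injf /val_inj.
move=> x y fxy; have : v *+ x = v *+ y by apply: (addrI u); rewrite -!fE fxy.
move: v0; case/matrix0Pn=> i [j vij] /matrixP/(_ i j).
rewrite !mulmxnE -mulr_natr -[RHS]mulr_natr => /(mulfI vij)/eqP.
by rewrite eqr_nat => /eqP.
Qed.

Section Roots.
Variables (n : nat) (D : root_datum n).
Implicit Types (a b c i j : D).

Lemma rt_neq0 a : rt a != 0.
Proof. by apply/eqP => a0; have := rt_crt a; rewrite a0 pairing0l. Qed.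

Lemma srefl_crt a b :
  srefl a *m crt b = crt b - pairing (rt a) (crt b) *: crt a.
Proof. by rewrite /srefl mulmxBl mul1mx mulmx_pairing. Qed.

Lemma vec_srefl a (x : 'rV[int]_n) : x *m srefl a =
  x - pairing x (crt a) *: rt a.
Proof. by rewrite /srefl mulmxBr mulmx1 pairing_mulmx. Qed.

Lemma rt_srefl a b :
  rt b *m srefl a = rt b - pairing (rt b) (crt a) *: rt a.
Proof. exact: vec_srefl. Qed.

Lemma srefl_vec a (l : 'cV[int]_n) :
  srefl a *m l = l - pairing (rt a) l *: crt a.
Proof. by rewrite /srefl mulmxBl mul1mx mulmx_pairing. Qed.

Lemma sreflK a : srefl a *m srefl a = 1%:M.
Proof.
rewrite {2}/srefl mulmxBr mulmx1 mulmxA srefl_crt rt_crt.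
by rewrite scaler_nat mulr2n opprD addNKr mulNmx opprK /srefl subrK.
Qed.

(* Two coroots, or two roots, differing by a vector orthogonal to all roots
   generate an infinite progression, as [- s_e'(e) = e + 2 d]. *)
Lemma crt_radical (e e' : D) (d : 'cV[int]_n) :
  (forall a, pairing (rt a) d = 0) -> crt e' = crt e + d -> d = 0.
Proof.
move=> rad ee'; apply: (@finite_progression D _ _ (@crt n D) (crt e)).
have neg a : exists b, crt b = - crt a.
  have [b bE] := crt_stable a a; exists b.
  by rewrite bE rt_crt scaler_nat mulr2n opprD addNKr.
(* Two consecutive terms are carried through the induction: minus the reflection of the earlier one
   in the later one is the next term. *)
suff H k : (exists i, crt i = crt e + d *+ k) /\
           (exists i, crt i = crt e + d *+ k.+1) by move=> k; case: (H k).
elim: k => [|k [[i iE] [j jE]]].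
  by split; [exists e; rewrite addr0|exists e'].
split; first by exists j.
have [x xE] := crt_stable j i; have [y yE] := neg x; exists y.
have p2 : pairing (rt j) (crt i) = 2.
  have ji : crt j = crt i + d by rewrite iE jE mulrSr addrA.
  by rewrite -(rt_crt j) [in RHS]ji pairingDr rad addr0.
rewrite yE xE p2 iE jE !mulrSr; apply/matrixP => p q; rewrite !mxE; ring.
Qed.

Lemma rt_radical (e e' : D) (d : 'rV[int]_n) :
  (forall a, pairing d (crt a) = 0) -> rt e' = rt e + d -> d = 0.
Proof.
move=> rad ee'; apply: (@finite_progression D _ _ (@rt n D) (rt e)).
have neg a : exists b, rt b = - rt a.
  have [b bE] := rt_stable a a; exists b.
  by rewrite bE rt_crt scaler_nat mulr2n opprD addNKr.
suff H k : (exists i, rt i = rt e + d *+ k) /\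
           (exists i, rt i = rt e + d *+ k.+1) by move=> k; case: (H k).
elim: k => [|k [[i iE] [j jE]]].
  by split; [exists e; rewrite addr0|exists e'].
split; first by exists j.
have [x xE] := rt_stable j i; have [y yE] := neg x; exists y.
have p2 : pairing (rt i) (crt j) = 2.
  have ji : rt j = rt i + d by rewrite iE jE mulrSr addrA.
  by rewrite -(rt_crt j) [in RHS]ji pairingDl rad addr0.
rewrite yE xE p2 iE jE !mulrSr; apply/matrixP => p q; rewrite !mxE; ring.
Qed.

(* The datum only gives [s_a(b)] and [s_a(b^vee)] separately.  They correspond:
   otherwise [s_c s_a s_b s_a], with [c = s_a(b)], would be a nontrivial
   transvection permuting the roots. *)
Lemma srefl_root a b :
  exists c, rt c *m srefl a = rt b /\ crt c = srefl a *m crt b.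
Proof.
have [c cE] := rt_stable a b; exists c.
have cE' : rt c = rt b *m srefl a by rewrite rt_srefl.
have cb : rt c *m srefl a = rt b by rewrite cE' -mulmxA sreflK mulmx1.
split=> //.
have [c' c'E] := crt_stable a b; rewrite -srefl_crt in c'E.
have stab (e x : D) : exists y : D, rt y = rt x *m srefl e.
  by have [y yE] := rt_stable e x; exists y; rewrite rt_srefl.
pose d := srefl a *m crt b - crt c.
have cd : pairing (rt c) d = 0.
  by rewrite pairingDr pairingNr -pairing_mul cb !rt_crt subrr.
(* This transvection arises by applying [s_a], [s_b], [s_a], [s_c] in turn, as [s_a s_b s_a] is the
   reflection with root [c] and coroot that of [c']. *)
have tE (x : D) : exists y : D, rt y = rt x + pairing (rt x) d *: rt c.
  have [x1 x1E] := stab a x; have [x2 x2E] := stab b x1.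
  have [x3 x3E] := stab a x2; have [x4 x4E] := stab c x3; exists x4.
  have x3' : rt x3 = rt x - pairing (rt x) (crt c') *: rt c.
    rewrite x3E x2E x1E (vec_srefl b) mulmxBl -scalemxAl -cE' -mulmxA sreflK.
    by rewrite mulmx1 pairing_mul -c'E.
  rewrite x4E vec_srefl x3' /d -c'E !pairingE rt_crt.
  apply/matrixP => p q; rewrite !mxE; ring.
(* As [<c, d> = 0], iterating the transvection adds the same multiple of [c] each time: an infinite
   progression of roots unless that multiple is zero. *)
have d0 : forall x : D, pairing (rt x) d = 0.
  move=> x; apply/eqP.
  have : pairing (rt x) d *: rt c = 0.
    apply: (@finite_progression D _ _ (@rt n D) (rt x)) => k.
    elim: k => [|k [i iE]]; first by exists x; rewrite addr0.
    have [j jE] := tE i; exists j.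
    rewrite jE iE pairingDl mulrSr addrA; congr (_ + _).
    by rewrite -scaler_nat !pairingZl cd !mulr0 addr0.
  move/matrixP=> E; have /matrix0Pn[p [q cpq]] := rt_neq0 c.
  by have /eqP := E p q; rewrite !mxE mulf_eq0 (negPf cpq) orbF.
have dE : crt c' = crt c + d by rewrite /d c'E addrC subrK.
by have /eqP := crt_radical d0 dE; rewrite subr_eq0 => /eqP.
Qed.

(** The default [a] is never returned by a failed search: a root with value [- rt a] always
    exists. *)
Definition ropp a : D := odflt a [pick b : D | rt b == - rt a].

Lemma ropp_spec a : rt (ropp a) = - rt a /\ crt (ropp a) = - crt a.
Proof.
have [b [bE cbE]] := srefl_root a a.
have bE' : rt b = - rt a.
  rewrite -[LHS]mulmx1 -(sreflK a) mulmxA bE rt_srefl rt_crt.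
  by rewrite scaler_nat mulr2n opprD addNKr.
have cbE' : crt b = - crt a.
  by rewrite cbE srefl_crt rt_crt scaler_nat mulr2n opprD addNKr.
rewrite /ropp; case: pickP => [c /eqP cE|/(_ b)]; last by rewrite bE' eqxx.
by have -> : c = b by apply: (@rt_inj _ D); rewrite cE bE'.
Qed.

Lemma rt_opp a : rt (ropp a) = - rt a. Proof. exact: (ropp_spec a).1. Qed.
Lemma crt_opp a : crt (ropp a) = - crt a. Proof. exact: (ropp_spec a).2. Qed.

(* Invariant under the Weyl group because of [srefl_root]; only semidefinite,
   as the roots need not span. *)
Definition rform (x y : 'rV[int]_n) : int :=
  \sum_(c : D) pairing x (crt c) * pairing y (crt c).
Definition cform (x y : 'cV[int]_n) : int :=
  \sum_(c : D) pairing (rt c) x * pairing (rt c) y.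

(** Invariance under [s_a] gives [(a, y) = (-a, y - <y, a^vee> a)]; expand the right-hand side. *)
Lemma rform_crt a y : 2 * rform (rt a) y =
  pairing y (crt a) * rform (rt a) (rt a).
Proof.
have [f fE] := choice (srefl_root a).
have finj : injective f.
  by move=> b c bc; apply: (@rt_inj _ D); rewrite -(fE b).1 -(fE c).1 bc.
have inv x : rform (x *m srefl a) (y *m srefl a) = rform x y.
  rewrite /rform [RHS](reindex_inj finj) /=; apply: eq_bigr => c _.
  by rewrite (fE c).2 !pairing_mul.
have := inv (rt a); rewrite rt_srefl rt_crt.
rewrite vec_srefl /rform; set p := pairing y _ => E.
have : \sum_(c : D) (- (pairing (rt a) (crt c) * pairing y (crt c)) +
        p * (pairing (rt a) (crt c) * pairing (rt a) (crt c))) =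
    \sum_(c : D) pairing (rt a) (crt c) * pairing y (crt c).
  rewrite -E; apply: eq_bigr => c _; rewrite !pairingE; ring.
rewrite big_split /= sumrN -mulr_sumr addrC => /eqP; rewrite subr_eq => /eqP->.
by rewrite mulr_natl mulr2n.
Qed.

Lemma cform_rt a y : 2 * cform (crt a) y =
  pairing (rt a) y * cform (crt a) (crt a).
Proof.
have [f fE] := choice (srefl_root a).
have finj : injective f.
  by move=> b c bc; apply: (@rt_inj _ D); rewrite -(fE b).1 -(fE c).1 bc.
have inv x : cform (srefl a *m x) (srefl a *m y) = cform x y.
  rewrite /cform [LHS](reindex_inj finj) /=; apply: eq_bigr => c _.
  by rewrite -!pairing_mul (fE c).1.
have := inv (crt a); rewrite srefl_crt rt_crt srefl_vec.
rewrite /cform; set p := pairing (rt a) y => E.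
have : \sum_(c : D) (- (pairing (rt c) (crt a) * pairing (rt c) y) +
        p * (pairing (rt c) (crt a) * pairing (rt c) (crt a))) =
    \sum_(c : D) pairing (rt c) (crt a) * pairing (rt c) y.
  rewrite -E; apply: eq_bigr => c _; rewrite !pairingE; ring.
rewrite big_split /= sumrN -mulr_sumr addrC => /eqP; rewrite subr_eq => /eqP->.
by rewrite mulr_natl mulr2n.
Qed.

Lemma rform_ge0 x : 0 <= rform x x.
Proof. by apply: sumr_ge0 => c _; rewrite -expr2 sqr_ge0. Qed.

Lemma rform_eq0 x : rform x x <= 0 -> forall c : D, pairing x (crt c) = 0.
Proof.
move=> x0 c.
have x0' : rform x x = 0 by apply/eqP; rewrite eq_le x0 rform_ge0.
have ge (d : D) : true -> 0 <= pairing x (crt d) * pairing x (crt d).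
  by rewrite -expr2 sqr_ge0.
by have /eqP := psumr_eq0P ge x0' (i := c) isT; rewrite mulf_eq0 orbb => /eqP.
Qed.

Lemma rform_gt0 a : 0 < rform (rt a) (rt a).
Proof.
rewrite lt_neqAle rform_ge0 andbT; apply/eqP => r0.
by have := @rform_eq0 (rt a); rewrite -r0 lexx => /(_ isT a); rewrite rt_crt.
Qed.

Lemma cform_gt0 a : 0 < cform (crt a) (crt a).
Proof.
rewrite /cform (bigD1 a) //= rt_crt ltr_wpDr // sumr_ge0 // => c _.
by rewrite -expr2 sqr_ge0.
Qed.

Lemma rformC x y : rform x y = rform y x.
Proof. by apply: eq_bigr => c _; rewrite mulrC. Qed.

(** Both pairings have the sign of [rform (rt a) (rt b)], by [rform_crt] and positivity of the
    norms. *)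
Lemma pairing_gt0_sym a b :
  0 < pairing (rt b) (crt a) -> 0 < pairing (rt a) (crt b).
Proof.
have := rform_crt a (rt b); have := rform_crt b (rt a); rewrite rformC.
have := rform_gt0 a; have := rform_gt0 b;
  move: (rform _ _) (rform _ _) (rform _ _).
by move=> M N P; nia.
Qed.

(* If both pairings are at least 2 then [a - b] has nonpositive norm. *)
Lemma root_diff a b :
  0 < pairing (rt b) (crt a) -> b != a -> exists c, rt c = rt b - rt a.
Proof.
move=> mgt ba; have m'gt := pairing_gt0_sym mgt.
case: (eqVneq (pairing (rt b) (crt a)) 1) => [m1|m1].
  by have [c cE] := rt_stable a b; exists c; rewrite cE m1 scale1r.
case: (eqVneq (pairing (rt a) (crt b)) 1) => [m1'|m1'].
  have [c cE] := rt_stable b a; exists (ropp c).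
  by rewrite rt_opp cE m1' scale1r opprB.
exfalso; have := rform_crt a (rt b); have := rform_crt b (rt a).
rewrite [rform (rt b) (rt a)]rformC => Pb Pa.
(* With both pairings at least 2, [(a, b)] is at least [(a, a)] and at least [(b, b)]. *)
have d0 : rform (rt b - rt a) (rt b - rt a) <= 0.
  have -> : rform (rt b - rt a) (rt b - rt a) =
      rform (rt b) (rt b) + rform (rt a) (rt a) - 2 * rform (rt a) (rt b).
    rewrite /rform mulr_sumr -big_split -sumrB /=; apply: eq_bigr => c _.
    rewrite !pairingE; ring.
  have := rform_gt0 a; have := rform_gt0 b; nia.
have /eqP := @rt_radical a b _ (rform_eq0 d0) (esym (subrKC _ _)).
by rewrite subr_eq0 => /eqP/(@rt_inj _ D)/eqP; rewrite (negPf ba).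
Qed.

End Roots.

(** * Simple roots *)

Section Positive.
Variables (n : nat) (D : root_datum n) (pos : pred D).
Hypothesis hpos : positive_system pos.
Implicit Types (a b c : D).

Lemma pos_opp a : pos (ropp a) = ~~ pos a.
Proof.
have [x hx] := hpos; rewrite !(hx _).2 rt_opp pairingNl.
have := (hx a).1; lia.
Qed.

(** If [c] were negative, [a = b + (-c)] would split the simple root [a]. *)
Lemma simple_pos_diff a b c :
  simple_root pos a -> pos b -> rt c = rt b - rt a -> pos c.
Proof.
move=> [pa sa] pb cE; apply: contrapT => /negP; rewrite -pos_opp => pc.
by apply: sa; exists b, (ropp c); rewrite rt_opp cE opprB subrKC.
Qed.

(** Induction on the height [<b, x>]. If [c = b - m a] were negative, [d = b - a] and [e = -c - a]
    would both be positive roots, while [s_a(d) = -e] with [d] lower than [b]. *)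
Lemma srefl_simple_pos a b c : simple_root pos a -> pos b -> b != a ->
  rt c = rt b *m srefl a -> pos c.
Proof.
have [x hx] := hpos => sa; have posE d := (hx d).2.
have [N] := ubnP `|pairing (rt b) x|%N; elim: N b c => // N IHN b c hb pb ba cE.
apply: contrapT => /negP npc.
have hapos : 0 < pairing (rt a) x by rewrite -posE; case: sa.
have hbpos : 0 < pairing (rt b) x by rewrite -posE.
rewrite vec_srefl in cE.
have m0 : 0 < pairing (rt b) (crt a).
  rewrite ltNge; apply/negP => m0; move: npc; rewrite posE cE !pairingE; nia.
have [d dE] := root_diff m0 ba; have pd := simple_pos_diff sa pb dE.
have c'E : rt (ropp c) = pairing (rt b) (crt a) *: rt a - rt b.
  by rewrite rt_opp cE opprB.
have c'a : pairing (rt (ropp c)) (crt a) = pairing (rt b) (crt a).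
  rewrite c'E !pairingE rt_crt; ring.
have nc : ropp c != a.
  apply/eqP => ca; move: c'a; rewrite ca rt_crt => m2.
  move: c'E; rewrite ca -m2 => /matrixP aE; move/negP: ba; apply.
  apply/eqP/(@rt_inj _ D)/matrixP => p q.
  have := aE p q; rewrite !mxE; move: (rt a p q) (rt b p q) => X Y; lia.
have [e eE] : exists e : D, rt e = rt (ropp c) - rt a by apply: root_diff;
  rewrite ?c'a.
have pe : pos e by apply: simple_pos_diff sa _ eE; rewrite pos_opp.
(* [d = a] would mean [b = 2 a], against reducedness. *)
have [da|da] := eqVneq d a.
  apply: (@rt_reduced _ D a b).
  by rewrite -[rt b](subrK (rt a)) -dE da scaler_nat mulr2n.
have : pos (ropp e).
  apply: (IHN d) => //.
    by have := pd; rewrite posE dE !pairingE; lia.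
  rewrite rt_opp eE rt_opp cE vec_srefl dE !pairingE rt_crt.
  apply/matrixP => p q; rewrite !mxE; ring.
by rewrite pos_opp pe.
Qed.

Lemma pos_sum_simple a : pos a -> exists2 r : seq D,
  forall b, b \in r -> simple_root pos b & rt a = \sum_(b <- r) rt b.
Proof.
have [x hx] := hpos; have posE d := (hx d).2.
have [N] := ubnP `|pairing (rt a) x|%N; elim: N a => // N IHN a ha pa.
have [sa|nsa] := pselect (simple_root pos a).
  by exists [:: a]; rewrite ?big_seq1 // => b; rewrite inE => /eqP->.
have [b [c [pb pc aE]]] : exists b c, [/\ pos b, pos c & rt a = rt b + rt c].
  by apply: contrapT => H; apply: nsa.
have := pb; have := pc; rewrite !posE => hc hb.
rewrite aE pairingDl in ha.
have [||r rs rE] := IHN b; [lia|by []|].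
have [||q qs qE] := IHN c; [lia|by []|].
exists (r ++ q); last by rewrite big_cat /= -rE -qE.
by move=> d; rewrite mem_cat => /orP[/rs|/qs].
Qed.

Lemma finrefl_opp a : finrefl (ropp a) = finrefl a.
Proof. by rewrite /finrefl /srefl rt_opp crt_opp mulmxN mulNmx opprK. Qed.

Lemma finrefl_unit a : (finrefl a).2 \in unitmx.
Proof. by have /mulmx1_unit[] := sreflK a. Qed.

Lemma finrefl2 a : finrefl a ** finrefl a = aone n.
Proof. by rewrite /finrefl /amul /= mulmx0 addr0 sreflK. Qed.

Lemma ainv_finrefl a : ainv (finrefl a) = finrefl a.
Proof. exact: ainv_uniq (finrefl_unit a) (finrefl2 a). Qed.

Lemma finrefl_conj a b c : rt c *m srefl a = rt b -> crt c = srefl a *m crt b ->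
  finrefl c = finrefl a ** finrefl b ** finrefl a.
Proof.
move=> bE cE; rewrite /finrefl /amul /= mulmx0 addr0; congr (_, _).
  by rewrite mulmx0 addr0.
rewrite [srefl b]/srefl (mulmxBr (srefl a)) (mulmx1 (srefl a)).
rewrite (mulmxBl (srefl a)) sreflK.
by rewrite mulmxA -cE -bE -!mulmxA sreflK mulmx1.
Qed.

Lemma simple_reflV g : simple_refl pos g -> g.2 \in unitmx /\ g ** g = aone n.
Proof. by move=> [a _ ->]; rewrite finrefl_unit finrefl2. Qed.

(* A positive non-simple root [a] has a simple root [b] with
   [<b, a^vee> > 0], and [s_b(a)] is a lower positive root. *)
Lemma finrefl_reflection a : reflections (simple_refl pos) (finrefl a).
Proof.
have [x hx] := hpos; have posE d := (hx d).2.
wlog pa : a / pos a.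
  move=> H; have [/H//|/negP npa] := boolP (pos a).
  by rewrite -finrefl_opp; apply: H; rewrite pos_opp; apply/negP.
have [N] := ubnP `|pairing (rt a) x|%N; elim: N a pa => // N IHN a pa ha.
have [sa|nsa] := pselect (simple_root pos a).
  exists (aone n), (finrefl a); split; [exact: generated1|by exists a|].
  by rewrite amul1g (@ainv_uniq _ (aone n) (aone n)) ?unitmx1 ?amulg1.
have [r rs rE] := pos_sum_simple pa.
(* Otherwise [<a, a^vee> = 2] would be a sum of nonpositive terms. *)
have [b br b0] : exists2 b, b \in r & 0 < pairing (rt b) (crt a).
  apply: contrapT => H; have := rt_crt a.
  suff : pairing (rt a) (crt a) <= 0 by lia.
  rewrite [in rt a]rE /pairing mulmx_suml summxE big_seq;
    apply: sumr_le0 => b br.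
  by rewrite leNgt; apply/negP => b0; apply: H; exists b.
have sb := rs b br; have ab : a != b by apply/eqP => ab; apply: nsa; rewrite ab.
have b1 := pairing_gt0_sym b0.
have [c [cE ccE]] := srefl_root b a.
have cE' : rt c = rt a *m srefl b by rewrite -cE -mulmxA sreflK mulmx1.
have pc := srefl_simple_pos sb pa ab cE'.
have := pa; have := pc; have : pos b by case: sb.
rewrite !posE cE' vec_srefl !pairingE => hb hc hapos.
have [||u [s [gu ss sE]]] := IHN c => //.
  rewrite cE' vec_srefl !pairingE; nia.
have Sb : simple_refl pos (finrefl b) by exists b.
exists (finrefl b ** u), s; split=> //.
  by apply: generatedM => //; apply: generated_gen.
have [uu _] := generatedV simple_reflV gu.
rewrite ainvM ?finrefl_unit // ainv_finrefl (@finrefl_conj b c a) //;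
  last first.
  by rewrite ccE mulmxA sreflK mul1mx.
by rewrite sE !amulA.
Qed.

Lemma finrefl_generated a : generated (simple_refl pos) (finrefl a).
Proof.
have [u [s [gu ss ->]]] := finrefl_reflection a.
have [_ gu'] := generatedV simple_reflV gu.
by do 2?apply: generatedM => //; apply: generated_gen.
Qed.

Lemma weyl_simple : weyl D = generated (simple_refl pos).
Proof.
apply/seteqP; split; apply: generated_le => g.
  by move=> [a ->]; exact: finrefl_generated.
by move=> [a _ ->]; apply: generated_gen; exists a.
Qed.

Lemma weylV g : weyl D g -> g.2 \in unitmx /\ weyl D (ainv g).
Proof. by rewrite weyl_simple; exact/generatedV/simple_reflV. Qed.

End Positive.

(** * Affine roots and the base alcove *)

Section AffineRoots.
Variables (n : nat) (D : root_datum n) (pos : pred D).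
Hypothesis hpos : positive_system pos.
Implicit Types (a b : D) (c d e : aroot D) (g h : aff n).

Definition aopp c : aroot D := (ropp c.1, - c.2).

(* [c] is positive on the base alcove, where positive roots take values in
   the open unit interval. *)
Definition cpos c : bool := if pos c.1 then 0 <= c.2 else 1 <= c.2.

(* The affine function [c] is carried to [d] by [g], i.e. [d \o g = c]. *)
Definition maps g c d : Prop :=
  [/\ rt d.1 *m g.2 = rt c.1, crt d.1 = g.2 *m crt c.1
    & d.2 = c.2 - pairing (rt d.1) g.1].

Lemma cpos_opp c : cpos (aopp c) = ~~ cpos c.
Proof. by rewrite /cpos /= (pos_opp hpos); case: (pos _) => /=; lia. Qed.

Lemma arefl_opp c : arefl (aopp c) = arefl c.
Proof.
by rewrite /arefl /srefl /= rt_opp crt_opp mulmxN mulNmx !opprK scalerN scaleNr.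
Qed.

Lemma maps1 c : maps (aone n) c c.
Proof. by split; rewrite /= ?mulmx1 ?mul1mx // /pairing mulmx0 mxE subr0. Qed.

Lemma mapsM g h c d e : maps h c d -> maps g d e -> maps (g ** h) c e.
Proof.
move=> [cd cd' cd2] [de de' de2]; split => /=; rewrite ?mulmxA ?de //.
  by rewrite de' cd' mulmxA.
by rewrite de2 cd2 pairingDr -pairing_mul de opprD addrA addrAC.
Qed.

Lemma maps_fun g c d d' : g.2 \in unitmx -> maps g c d -> maps g c d' -> d = d'.
Proof.
move=> ug [cd _ cd2] [cd' _ cd2']; case: d d' cd cd2 cd' cd2' => [a k] [b m] /=.
move=> cd kE cd' mE; have ab : a = b.
  by apply: (@rt_inj _ D); rewrite -(mulmxK ug (rt a)) cd -cd' mulmxK.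
by rewrite kE mE ab.
Qed.

Lemma maps_opp g c d : maps g c d -> maps g (aopp c) (aopp d).
Proof.
move=> [cd cd' cd2]; split; rewrite /= ?rt_opp ?crt_opp.
- by rewrite mulNmx cd.
- by rewrite cd' mulmxN.
- by rewrite cd2 pairingNl opprD.
Qed.

Lemma maps_conj g c d : maps g c d -> g ** arefl c = arefl d ** g.
Proof.
move=> [cd cd' cd2]; rewrite /amul /arefl /=; congr (_, _).
  rewrite srefl_vec cd2 -scalemxAr -cd'; apply/matrixP => p q; rewrite !mxE;
    ring.
by rewrite /srefl mulmxBr mulmx1 mulmxBl mul1mx mulmxA -cd' -mulmxA cd.
Qed.

Lemma arefl_unit c : (arefl c).2 \in unitmx.
Proof. exact: finrefl_unit. Qed.

Lemma arefl2 c : arefl c ** arefl c = aone n.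
Proof.
rewrite /amul /arefl /= sreflK; congr (_, _).
rewrite -scalemxAr srefl_crt rt_crt; apply/matrixP => p q; rewrite !mxE; ring.
Qed.

Lemma maps_arefl c : maps (arefl c) c (aopp c).
Proof.
split; rewrite /= ?rt_opp ?crt_opp.
- rewrite mulNmx vec_srefl rt_crt; apply/matrixP => p q; rewrite !mxE; ring.
- rewrite srefl_crt rt_crt; apply/matrixP => p q; rewrite !mxE; ring.
- rewrite !pairingE rt_crt; ring.
Qed.

Lemma arefl0 a : arefl (a, 0) = finrefl a.
Proof. by rewrite /arefl /= oppr0 scale0r. Qed.

(** The translation part is unrestricted, since any integral translation carries affine roots to
    affine roots. *)
Definition automorphism g : Prop := g.2 \in unitmx /\
  forall a, exists b, rt b *m g.2 = rt a /\ crt b = g.2 *m crt a.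

Lemma automorphism_maps g : automorphism g -> forall c, exists d, maps g c d.
Proof.
move=> [ug Hg] [a k]; have [b [ab ab']] := Hg a.
by exists (b, k - pairing (rt b) g.1).
Qed.

Lemma automorphism_tr l : automorphism (tr l).
Proof. by split=> [|a]; [exact: unitmx1|exists a; rewrite mulmx1 mul1mx]. Qed.

Lemma automorphismM g h :
  automorphism g -> automorphism h -> automorphism (g ** h).
Proof.
move=> [ug Hg] [uh Hh]; split=> [|a]; first by rewrite unitmx_mul ug.
have [b [ab ab']] := Hh a; have [b' [bb bb']] := Hg b; exists b'.
by rewrite /= mulmxA bb ab bb' ab' mulmxA.
Qed.

Lemma automorphismV g : automorphism g -> automorphism (ainv g).
Proof.
move=> [ug /choice[f fE]]; split=> [|b]; first by rewrite ainv_unit.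
have finj : injective f.
  by move=> a c ac; apply: (@rt_inj _ D); rewrite -(fE a).1 -(fE c).1 ac.
have [E1 E2] := fE (invF finj b); rewrite f_invF in E1 E2.
by exists (invF finj b); rewrite /= E2 mulKmx // -E1 mulmxK.
Qed.

Lemma automorphism_arefl c : automorphism (arefl c).
Proof. by split=> [|a]; [exact: arefl_unit|exact: srefl_root]. Qed.

Lemma automorphism_generated (S : set (aff n)) :
  (forall g, S g -> exists c, g = arefl c) ->
  forall g, generated S g -> automorphism g.
Proof.
move=> SR _ [s sS <-]; elim: s sS => [|x s IHs] sS;
  first exact: automorphism_tr.
apply: automorphismM; last by apply: IHs => y ys; apply: sS;
  rewrite inE ys orbT.
by have [c ->] := SR x (sS x (mem_head _ _)); exact: automorphism_arefl.
Qed.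

Lemma automorphism_weyl g : weyl D g -> automorphism g.
Proof.
by apply: automorphism_generated => _ [a ->]; exists (a, 0); rewrite arefl0.
Qed.

Lemma automorphism_ext_weyl g : ext_weyl D g -> automorphism g.
Proof.
move=> [l [w [/automorphism_weyl aw ->]]].
by apply: automorphismM => //; exact: automorphism_tr.
Qed.

End AffineRoots.

(** * Points of the base alcove, hyperplanes and walls *)

Section Alcove.
Variables (R : realType) (n : nat) (D : root_datum n) (pos : pred D).
Hypothesis hpos : positive_system pos.
Implicit Types (a b : D) (c d e : aroot D) (g h : aff n) (x y z : 'cV[R]_n).

Local Notation alc := (@alcove R n D pos).
Local Notation calc := (@closed_alcove R n D pos).

Lemma rpairingD a x y : rpairing a (x + y) = rpairing a x + rpairing a y.
Proof. by rewrite /rpairing mulmxDr mxE. Qed.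

Lemma rpairingZ a (k : R) x : rpairing a (k *: x) = k * rpairing a x.
Proof. by rewrite /rpairing -scalemxAr mxE. Qed.

Lemma rpairing_int a (l : 'cV[int]_n) :
  rpairing a (map_mx intr l) = (pairing (rt a) l)%:~R :> R.
Proof. by rewrite /rpairing -map_mxM mxE. Qed.

Lemma rpairing_opp a x : rpairing (ropp a) x = - rpairing a x.
Proof. by rewrite /rpairing rt_opp map_mxN mulNmx mxE. Qed.

Lemma rpairing_mul a b x (M : 'M_n) : rt b *m M = rt a ->
  rpairing b (map_mx intr M *m x) = rpairing a x.
Proof. by move=> ab; rewrite /rpairing mulmxA -map_mxM ab. Qed.

Lemma aeval_maps g c d x : maps g c d -> aeval d (act g x) = aeval c x.
Proof.
move=> [cd _ cd2].
rewrite /aeval /act rpairingD rpairing_int (rpairing_mul _ cd) cd2 rmorphB /=.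
ring.
Qed.

Lemma aeval_opp c x : aeval (aopp c) x = - aeval c x.
Proof. by rewrite /aeval /= rpairing_opp rmorphN opprD. Qed.

Lemma cpos_alcove c x : cpos pos c -> alc x -> 0 < aeval c x.
Proof.
case: c => a k; rewrite /cpos /aeval /= => kpos xA.
case: ifP kpos => pa k0; first by have /andP[] := xA a pa;
  rewrite -(ler0z R) in k0; lra.
have : pos (ropp a) by rewrite (pos_opp hpos) pa.
move=> /xA; rewrite rpairing_opp -(ler1z R) in k0 *; lra.
Qed.

Lemma cpos_closed_alcove c x : cpos pos c -> calc x -> 0 <= aeval c x.
Proof.
case: c => a k; rewrite /cpos /aeval /= => kpos xA.
case: ifP kpos => pa k0; first by have /andP[] := xA a pa;
  rewrite -(ler0z R) in k0; lra.
have : pos (ropp a) by rewrite (pos_opp hpos) pa.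
move=> /xA; rewrite rpairing_opp -(ler1z R) in k0 *; lra.
Qed.

(** The witness is a regular cocharacter defining [pos], divided by an integer [N] exceeding the
    absolute values of all its pairings with roots. *)
Lemma alcove_point : exists x, forall a, pos a -> 0 < rpairing a x < 1.
Proof.
have [x hx] := hpos.
pose N : int := 1 + \sum_(a : D) `|pairing (rt a) x|.
have Ngt a : `|pairing (rt a) x| < N.
  by rewrite /N (bigD1 a) //= addrCA ltrDl ltr_pwDl // sumr_ge0.
have N0 : 0 < N by rewrite /N ltr_pwDl // sumr_ge0.
exists (N%:~R^-1 *: map_mx intr x) => a; rewrite (hx a).2 => ax.
rewrite rpairingZ rpairing_int mulr_gt0 ?invr_gt0 ?ltr0z //=.
by rewrite mulrC ltr_pdivrMr ?ltr0z // mul1r ltr_int (le_lt_trans (ler_norm _)).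
Qed.

(** The sign of an affine root can be read off at any single point of the alcove, and [s] carries
    alcove points to alcove points. *)
Lemma omega_maps s c d : omega R pos s -> maps s c d -> cpos pos d = cpos pos c.
Proof.
move=> [_ sA] cd; have [x xA] := alcove_point.
have sxA : alc (act s x) by rewrite -sA; exists x.
have E := aeval_maps x cd.
have sgn e y : alc y -> cpos pos e = (0 < aeval e y).
  move=> yA; have [/cpos_alcove-/(_ _ yA)->//|] := boolP (cpos pos e).
  rewrite -cpos_opp // => /cpos_alcove-/(_ _ yA).
  by rewrite aeval_opp oppr_gt0 => /ltW; rewrite leNgt => /negPf->.
by rewrite (sgn _ _ sxA) (sgn _ x xA) E.
Qed.

(* Equal hyperplanes have proportional equations, and the factor is a sign by
   reducedness. *)
Lemma hyperplane_arefl (b c : aroot D) x : on_hyperplane b x ->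
  on_hyperplane c x ->
  @on_hyperplane R n D b = @on_hyperplane R n D c -> arefl b = arefl c.
Proof.
move=> bx cx bc.
have half (e f : aroot D) : aeval f x = 0 -> aeval e x = 0 ->
    (forall y, aeval f y = 0 -> aeval e y = 0) ->
    2 *: rt e.1 = pairing (rt e.1) (crt f.1) *: rt f.1.
  move=> fx ex sub; apply/rowP => i.
  pose z : 'cV[int]_n := delta_mx i 0.
  have zE (u : 'rV[int]_n) : pairing u z = u 0 i.
    by rewrite /pairing -colE mxE.
  (* The added vector is killed by [rt f.1], so [y] stays on the hyperplane of [f]; evaluating [e]
     there yields the [i]-th coordinate of the identity. *)
  pose y := x + map_mx intr (2 *: z - pairing (rt f.1) z *: crt f.1).
  have : aeval e y = 0.
    apply: sub; rewrite /y /aeval rpairingD rpairing_int !pairingE rt_crt.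
    by rewrite mulrC subrr addr0.
  rewrite /y /aeval rpairingD addrAC -/(aeval e x) ex add0r rpairing_int.
  move=> /eqP; rewrite intr_eq0 !pairingE !zE !mxE subr_eq0 => /eqP->.
  by rewrite mulrC.
have H1 := half b c cx bx; have H2 := half c b bx cx.
have {H1} H1 : 2 *: rt b.1 = pairing (rt b.1) (crt c.1) *: rt c.1.
  by apply: H1 => y cy; have : on_hyperplane b y by rewrite bc.
have {H2} H2 : 2 *: rt c.1 = pairing (rt c.1) (crt b.1) *: rt b.1.
  by apply: H2 => y cy; have : on_hyperplane c y by rewrite -bc.
have pp : pairing (rt b.1) (crt c.1) * pairing (rt c.1) (crt b.1) = 4.
  have := congr1 (fun u => pairing u (crt b.1)) H1.
  by rewrite !pairingZl rt_crt => <-.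
have rtb : rt b.1 = rt c.1 \/ rt b.1 = - rt c.1.
  move: H1 H2 pp; set p := pairing _ _; set q := pairing _ _ => H1 H2 pq.
  have red (e f : D) : rt e <> 2 *: rt f /\ rt e <> - 2 *: rt f.
    split; first exact: rt_reduced.
    by rewrite scaleNr -scalerN -rt_opp; exact: rt_reduced.
  (* From [p q = 4], either [p] is 2 or -2 and the gradients are equal or opposite, or some factor
     is 1 or -1, which contradicts reducedness. *)
  have [p2|[p2|[p1|[p1|[q1|q1]]]]] : p = 2 \/ p = - 2 \/ p = 1 \/ p = - 1 \/
      q = 1 \/ q = - 1.
    have : `|p| * `|q| = 4 by rewrite -normrM pq.
    have [p0|p0] := lerP 0 p; have [q0|q0] := lerP 0 q; rewrite -?normrM; nia.
  - left; apply/matrixP => i j; have /matrixP/(_ i j) := H1.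
    by rewrite p2 !mxE; move: (rt b.1 i j) (rt c.1 i j) => X Y; lia.
  - right; apply/matrixP => i j; have /matrixP/(_ i j) := H1.
    by rewrite p2 !mxE; move: (rt b.1 i j) (rt c.1 i j) => X Y; lia.
  - by have [] := red c.1 b.1; rewrite H1 p1 scale1r.
  - by have [_] := red c.1 b.1; rewrite scaleNr H1 p1 scaleN1r opprK.
  - by have [] := red b.1 c.1; rewrite H2 q1 scale1r.
  - by have [_] := red b.1 c.1; rewrite scaleNr H2 q1 scaleN1r opprK.
move: bx cx; rewrite /on_hyperplane /= /aeval => bx cx.
case: rtb => [/(@rt_inj _ D) bc1|].
  suff -> : b = c by [].
  case: b c bc1 bx cx {bc half H1 H2 pp} => [b k] [c m] /= -> /eqP.
  rewrite addr_eq0 => /eqP-> /eqP.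
  by rewrite addrC subr_eq0 => /eqP/intr_inj->.
rewrite -rt_opp => /(@rt_inj _ D) bc1; rewrite -(arefl_opp c).
suff -> : b = aopp c by [].
case: b c bc1 bx cx {bc half H1 H2 pp} => [b k] [c m] /= -> /eqP.
rewrite rpairing_opp addrC subr_eq0 => /eqP <- /eqP.
by rewrite -intrD intr_eq0 addr_eq0 /aopp => /eqP->.
Qed.

(** The point [x] witnessing the wall is fixed by [arefl c], so [d] and [d'] agree there, one being
    nonnegative and the other nonpositive. Hence [d] vanishes at [x], which lies on no hyperplane
    other than that of [c]. *)
Lemma wall_exchange c d d' : wall R pos c -> cpos pos d ->
  maps (arefl c) d d' ->
  ~~ cpos pos d' -> arefl d = arefl c.
Proof.
move=> [x [xA cx uniq]] dpos dd'; rewrite -cpos_opp // => d'neg.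
have fx : act (arefl c) x = x.
  move: cx; rewrite /on_hyperplane /= /aeval /rpairing => cx.
  rewrite /act /arefl /= /srefl map_mxB map_mx1 mulmxBl mul1mx map_mxM -mulmxA.
  rewrite [map_mx intr (rt c.1) *m x]mx11_scalar mul_mx_scalar map_mxZ.
  rewrite rmorphN /= (_ : _%:~R = - (map_mx intr (rt c.1) *m x) 0 0).
    by rewrite opprK addrCA subrr addr0.
  by apply/eqP; rewrite -addr_eq0 addrC cx.
have := aeval_maps x dd'; rewrite fx => E.
have dx : on_hyperplane d x.
  apply/eqP; rewrite eq_le (cpos_closed_alcove dpos xA) andbT -E.
  by rewrite -oppr_ge0 -aeval_opp cpos_closed_alcove.
exact: hyperplane_arefl dx cx (uniq d dx).
Qed.

(* The midpoint of [x] and [s_a x], for [x] in the base alcove, lies on no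
   other affine root hyperplane because [s_a] permutes the other positive
   roots. *)
Lemma simple_wall a : simple_root pos a -> wall R pos (a, 0).
Proof.
move=> sa; have pa : pos a by case: sa.
have [x xA] := alcove_point.
pose y := x + (- (rpairing a x / 2)) *: map_mx intr (crt a).
have yE b : rpairing b y =
    rpairing b x - rpairing a x / 2 * (pairing (rt b) (crt a))%:~R.
  by rewrite /y rpairingD rpairingZ rpairing_int mulNr.
have ya : rpairing a y = 0 by rewrite yE rt_crt; lra.
have yb b : pos b -> b != a -> 0 < rpairing b y < 1.
  move=> pb ba; have [c [cE _]] := srefl_root a b.
  have cE' : rt c = rt b *m srefl a by rewrite -cE -mulmxA sreflK mulmx1.
  have pc := srefl_simple_pos hpos sa pb ba cE'.
  have cx : rpairing c x =
      rpairing b x - (pairing (rt b) (crt a))%:~R * rpairing a x.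
    rewrite /rpairing cE' vec_srefl map_mxB map_mxZ mulmxBl -scalemxAl.
    by rewrite !mxE.
  have := xA b pb; have := xA c pc; rewrite cx yE; lra.
exists y; split.
- move=> b pb; have [->|ba] := eqVneq b a; first by rewrite ya lexx ler01.
  by have /andP[/ltW-> /ltW->] := yb b pb ba.
- by rewrite /on_hyperplane /= /aeval ya addr0.
move=> [b k]; rewrite /on_hyperplane /= /aeval /= => /eqP by0.
have k_int (r : R) (m : int) : r + m%:~R == 0 -> 0 < r < 1 -> False.
  rewrite addr_eq0 => /eqP->; rewrite -rmorphN /= ltr0z ltrz1; lia.
have [ba|nba] := eqVneq b a.
  by move: by0; rewrite ba ya add0r intr_eq0 => /eqP->.
have [ba|nba'] := eqVneq (ropp b) a.
  have b0 : rpairing b y = 0 by apply/eqP;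
    rewrite -oppr_eq0 -rpairing_opp ba ya.
  move: by0; rewrite b0 add0r intr_eq0 => /eqP->.
  apply/seteqP; split=> z /=; rewrite -ba rpairing_opp !addr0 => /eqP.
    by move/eqP->; rewrite oppr0.
  by rewrite oppr_eq0 => /eqP.
exfalso; have [pb|npb] := boolP (pos b); first exact: k_int by0 (yb b pb nba).
have := yb (ropp b); rewrite (pos_opp hpos) => /(_ npb nba').
apply: (k_int _ (- k)); rewrite rpairing_opp rmorphN -opprD oppr_eq0.
exact: by0.
Qed.

Lemma simple_refl_aff : simple_refl pos `<=` aff_simple_refl R pos.
Proof.
by move=> _ [a sa ->]; exists (a, 0); [exact: simple_wall|rewrite arefl0].
Qed.

End Alcove.

(** * Exchange condition and length *)

Section Exchange.
Variables (R : realType) (n : nat) (D : root_datum n) (pos : pred D).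
Hypothesis hpos : positive_system pos.
Implicit Types (a b : D) (c d e : aroot D) (g h : aff n).

Local Notation T := (aff_simple_refl R pos).

(* Both [(W, simple_refl)] and [(W_aff, aff_simple_refl)] are covered by taking
   any set [S] of affine simple reflections. *)
Variable S : set (aff n).
Hypothesis ST : S `<=` T.

Lemma generated_automorphism g : generated S g -> automorphism D g.
Proof. by apply: automorphism_generated => h /ST[c _ ->]; exists c. Qed.

Lemma generated_unit g : generated S g -> g.2 \in unitmx.
Proof. by move=> /generated_automorphism[]. Qed.

Lemma generated_inv g : generated S g -> generated S (ainv g).
Proof.
move=> gg; have [//|_ //] := generatedV _ gg.
by move=> h /ST[c _ ->]; rewrite arefl_unit arefl2.
Qed.

Lemma reflections_generated t : reflections S t -> generated S t.
Proof.
move=> [u [s [gu /generated_gen gs ->]]]; apply: generatedM (generated_inv gu).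
exact: generatedM.
Qed.

Lemma reflections_arefl t : reflections S t -> exists2 c, cpos pos c & t =
  arefl c.
Proof.
move=> [u [s [gu /ST[c _ ->] ->]]].
have [d cd] := automorphism_maps (generated_automorphism gu) c.
have tE : u ** arefl c ** ainv u = arefl d.
  by rewrite (maps_conj cd) amulgK // generated_unit.
have [dpos|] := boolP (cpos pos d); first by exists d.
by rewrite -cpos_opp // => dpos; exists (aopp d) => //; rewrite arefl_opp.
Qed.

(** Apply the letters to [c] from the right. Some letter [x] turns a positive root [e] into a
    negative one; then [x = arefl e] by [wall_exchange], and multiplying by [arefl c] deletes this
    letter. *)
Lemma exchange (s : seq (aff n)) c d :
  (forall x, x \in s -> S x) -> cpos pos c -> maps (aprod s) c d ->
  ~~ cpos pos d ->
  exists r, [/\ forall x, x \in r -> S x, (size r < size s)%N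
              & aprod r = aprod s ** arefl c].
Proof.
elim: s c d => [|x s IHs] c d sS cpos_c.
  move=> /(@maps_fun _ _ (aone n) _ _ _ (unitmx1 _ _) (maps1 c))<-.
  by rewrite cpos_c.
have sS' y : y \in s -> S y by move=> ys; apply: sS; rewrite inE ys orbT.
have Sx : S x by apply: sS; rewrite mem_head.
have gs : generated S (aprod s) by exists s.
have [e ce] := automorphism_maps (generated_automorphism gs) c.
have [f ef] := automorphism_maps (generated_automorphism (generated_gen Sx)) e.
move=> /= cd; have := mapsM ce ef.
have ug : (x ** aprod s).2 \in unitmx.
  by apply/generated_unit/generatedM => //; exact: generated_gen.
move=> /(maps_fun ug cd) df; rewrite {}df {d cd} => npos_f.
have [pos_e|npos_e] := boolP (cpos pos e); last first.
  have [r [rS rs rE]] := IHs c e sS' cpos_c ce npos_e.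
  exists (x :: r); split=> //=; last by rewrite rE amulA.
  by move=> y; rewrite inE => /orP[/eqP->//|]; exact: rS.
exists s; split=> //=.
have [c0 wc0 xE] := ST Sx; rewrite xE in ef *.
rewrite -amulA (maps_conj ce) (wall_exchange hpos wc0 pos_e ef npos_f).
by rewrite amulA arefl2 amul1g.
Qed.

(** [exchange] shortens a reduced word of [g] if [d] is negative, and a reduced word of
    [g ** arefl c], which carries [c] to [aopp d], if [d] is positive. *)
Lemma has_length_lt g c d m k : cpos pos c -> maps g c d ->
  has_length S g m -> has_length S (g ** arefl c) k -> (m < k)%N = cpos pos d.
Proof.
move=> pos_c cd [[s [sS sg <-]] mins] [[r [rS rg <-]] minr].
have gg : generated S g by exists s.
apply/idP/idP => [sr|pos_d].
  apply: contraT => npos_d; rewrite -sg in cd.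
  have [r' [r'S r's r'E]] := exchange sS pos_c cd npos_d.
  rewrite sg in r'E; have := leq_ltn_trans (minr r' r'S r'E) r's.
  by rewrite ltnNge (ltnW sr).
have ccd := mapsM (maps_arefl c) (maps_opp cd).
rewrite -rg in ccd; have [|r' [r'S r'r r'E]] := exchange rS pos_c ccd _.
  by rewrite cpos_opp // negbK.
rewrite rg -amulA arefl2 amulg1 in r'E.
exact: leq_ltn_trans (mins r' r'S r'E) r'r.
Qed.

(** Lengths give way to signs of affine roots, which do not depend on [S]; this makes the graphs of
    [W] and [W_aff] comparable. *)
Lemma bruhat_edgeP g h : bruhat_edge S g h <->
  exists c d, [/\ generated S g, reflections S (arefl c), h = g ** arefl c,
    cpos pos c & maps g c d /\ cpos pos d].
Proof.
split=> [[gg [t [rt -> [m [k [mg kh mk]]]]]]|].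
  have [c pos_c tE] := reflections_arefl rt; rewrite tE in rt kh *.
  have [d cd] := automorphism_maps (generated_automorphism gg) c.
  by exists c, d; rewrite -(has_length_lt pos_c cd mg kh).
move=> [c [d [gg rc -> pos_c [cd pos_d]]]]; split=> //.
exists (arefl c); split=> //.
have [m mg] := has_length_ex gg.
have [k kg] := has_length_ex (generatedM gg (reflections_generated rc)).
by exists m, k; rewrite (has_length_lt pos_c cd mg kg).
Qed.

Lemma bruhat_edge_generated g h : bruhat_edge S g h -> generated S h.
Proof. by move=> [gg [t [/reflections_generated ? -> _]]];
  exact: generatedM. Qed.

Lemma bruhat_chain_generated g q : generated S g -> bruhat_chain S g q ->
  forall h, h \in g :: q -> generated S h.
Proof.
elim: q g => [|h q IHq] g gg /=; first by move=> _ k; rewrite inE => /eqP->.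
move=> [/bruhat_edge_generated gh hq] k; rewrite inE => /orP[/eqP->//|].
exact: IHq.
Qed.

Lemma bruhat_chain_edges g q : generated S g -> bruhat_chain S g q ->
  forall t, t \in edges (g :: q) -> reflections S t.
Proof.
elim: q g => //= h q IHq g gg [gh hq] t; rewrite inE => /orP[/eqP->|].
  by have [_ [u [ru -> _]]] := gh; rewrite amulKg // generated_unit.
exact: IHq (bruhat_edge_generated gh) hq t.
Qed.

End Exchange.

(** * Descent *)

Section Descent.
Variables (R : realType) (n : nat) (D : root_datum n) (pos : pred D).
Hypothesis hpos : positive_system pos.
Implicit Types (a b : D) (c d e : aroot D) (g h u v : aff n).

Local Notation T := (aff_simple_refl R pos).
Local Notation S := (simple_refl pos).

Lemma aff_weyl_automorphism g : aff_weyl R pos g -> automorphism D g.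
Proof. exact: (@generated_automorphism R n D pos T). Qed.

Lemma weyl_aff_weyl : weyl D `<=` aff_weyl R pos.
Proof.
rewrite (weyl_simple hpos); apply: generated_le => g Sg.
exact/generated_gen/simple_refl_aff.
Qed.

Lemma simple_reflections_aff : reflections S `<=` reflections T.
Proof.
move=> t [u [s [gu Ss ->]]]; exists u, s; split=> //.
  by apply: weyl_aff_weyl; rewrite (weyl_simple hpos).
exact: (simple_refl_aff R hpos Ss).
Qed.

Lemma omega_automorphism s : omega R pos s -> automorphism D s.
Proof. by move=> [/automorphism_ext_weyl]. Qed.

(* Elements of [Omega] preserve the positive affine roots, so no word for
   such an element is reduced unless it is empty. *)
Lemma omega_aff_weyl_trivial g : aff_weyl R pos g ->
  (forall c d, maps g c d -> cpos pos d = cpos pos c) -> g = aone n.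
Proof.
move=> [s sT <-]; have [N] := ubnP (size s); elim: N s sT => // N IHN s.
case/lastP: s => // s x; rewrite size_rcons => sT sN pres.
have Tx : T x by apply: sT; rewrite mem_rcons mem_head.
have sT' y : y \in s -> T y by move=> ys; apply: sT;
  rewrite mem_rcons inE ys orbT.
have [c pos_c xE] : exists2 c, cpos pos c & x = arefl c.
  apply: (@reflections_arefl R n D pos hpos T) => //; exists (aone n), x.
  split=> //; first exact: generated1.
  by rewrite amul1g (@ainv_uniq _ (aone n) (aone n)) ?unitmx1 ?amulg1.
have gs : generated T (aprod s) by exists s.
have [d cd] := automorphism_maps (aff_weyl_automorphism gs) c.
have ccd := mapsM (maps_arefl c) (maps_opp cd).
(* The full word carries the positive [c] to [aopp d] and preserves signs, so [d] is negative and
   [exchange] shortens the word. *)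
have npos_d : ~~ cpos pos d.
  by rewrite -cpos_opp // (pres c) // aprod_rcons xE.
have [r [rT rs rE]] := exchange hpos (@subset_refl _ T) sT' pos_c cd npos_d.
rewrite aprod_rcons xE -rE; apply: IHN => //; first exact: ltn_trans rs sN.
by move=> e f ef; apply: pres; rewrite aprod_rcons xE -rE.
Qed.

(** [ainv s ** s'] lies in [W_aff] and preserves the signs of affine roots, so it is trivial. *)
Lemma omega_uniq s s' w : w.2 \in unitmx ->
  omega R pos s -> omega R pos s' ->
  aff_weyl R pos (ainv s ** w) -> aff_weyl R pos (ainv s' ** w) -> s = s'.
Proof.
move=> uw os os' sw s'w.
have [us _] := omega_automorphism os; have [us' _] := omega_automorphism os'.
have g1 : aff_weyl R pos (ainv s ** s').
  have -> : ainv s ** s' = ainv s ** w ** ainv (ainv s' ** w).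
    by rewrite ainvM ?ainv_unit // ainvK // amulA amulgK.
  by apply: generatedM => //; apply: (@generated_inv R n D pos T).
have gE : ainv s ** s' = aone n.
  apply: (omega_aff_weyl_trivial g1) => c e ce.
  have [d cd] := automorphism_maps (omega_automorphism os') c.
  have se : maps s e d.
    have [f ef] := automorphism_maps (omega_automorphism os) e.
    have := mapsM ce ef; rewrite amulA amulgV // amul1g => /(maps_fun us' cd).
    by move=> ->.
  by rewrite -(omega_maps hpos os se) (omega_maps hpos os' cd).
by rewrite -[LHS]amulg1 -gE amulA amulgV // amul1g.
Qed.

(** Pair with a regular cocharacter [x] defining [pos] by the invariant form: twice the value on
    [b^vee] is [<b, x>] times the positive norm of [b^vee]. *)
Lemma height_exists : exists phi : 'cV[int]_n -> int,
  (forall l m : 'cV[int]_n, phi (l + m) = phi l + phi m) /\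
  forall b, pos b -> 0 < phi (crt b).
Proof.
have [x hx] := hpos; exists (cform D x); split=> [l m|b].
  by rewrite /cform -big_split; apply: eq_bigr => a _; rewrite pairingDr mulrDr.
rewrite (hx b).2 => bx; have := cform_rt b x; have := cform_gt0 b.
have -> : cform D (crt b) x = cform D x (crt b).
  by apply: eq_bigr => a _; rewrite mulrC.
move: bx; move: (pairing _ _) (cform _ _ _) (cform _ _ _) => p q r; nia.
Qed.

Lemma minuscule_weyl g (l : 'cV[int]_n) : automorphism D g -> minuscule D l ->
  minuscule D (g.2 *m l).
Proof.
move=> ag ml a; have [ug _] := ag;
  have [_ /(_ a)[b [ab _]]] := automorphismV ag.
by rewrite -pairing_mul -ab /= mulmxKV.
Qed.

(* Let [beta] be the gradient of the affine root [d = x(c)], [x = s u], and [l]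
   the image of the origin under [x].  Positivity of [c] and [d] gives
   [c.2, d.2 >= 0], while the origin is moved by [x arefl(c)] to
   [l' = l - c.2 beta^vee] with [<beta, l'> = - (c.2 + d.2) >= -1]. *)
Lemma descent_edge s u v : omega R pos s -> bruhat_edge T u v ->
  minuscule D (s ** v).1 -> minuscule D (s ** u).1 /\
  ((s ** u).1 = (s ** v).1 \/ exists2 b, pos b & (s ** u).1 =
    (s ** v).1 + crt b).
Proof.
move=> os /(bruhat_edgeP hpos (@subset_refl _ T)).
move=> [c [e [gu _ -> pos_c [ce pos_e]]]].
have [d ed] := automorphism_maps (omega_automorphism os) e.
have pos_d : cpos pos d by rewrite (omega_maps hpos os ed).
have cd := mapsM ce ed; rewrite amulA.
move: (s ** u) cd => x [_ cd' d2].
have -> : (x ** arefl c).1 = x.1 - c.2 *: crt d.1.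
  by rewrite /= -scalemxAr scaleNr -cd'.
move=> ml.
have c2 : 0 <= c.2 by move: pos_c; rewrite /cpos; case: ifP => _; lia.
have [d20 pd] : 0 <= d.2 /\ (d.2 = 0 -> pos d.1).
  by move: pos_d; rewrite /cpos; case: ifP => _; lia.
have pE : pairing (rt d.1) (x.1 - c.2 *: crt d.1) = - d.2 - c.2.
  by rewrite !pairingE rt_crt d2; ring.
have := ml d.1; rewrite pE !inE => sum_le.
have [c0|c1] : c.2 = 0 \/ c.2 = 1 by lia.
  by rewrite c0 scale0r subr0 in ml *; split=> //; left.
have d0 : d.2 = 0 by lia.
rewrite c1 scale1r in ml pE *; rewrite d0 in pE.
split; last by right; exists d.1; [exact: pd|rewrite subrK].
(* As [<beta, l'> = -1], the reflection in [beta] carries [l'] back to [l], so [l] inherits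
   minuscularity. *)
have -> : x.1 = srefl d.1 *m (x.1 - crt d.1).
  by rewrite srefl_vec pE sub0r scaleN1r opprK subrK.
exact: (@minuscule_weyl (arefl d) _ (automorphism_arefl d) ml).
Qed.

(** Backwards along the path, the height [phi] of the image of the origin never decreases and grows
    strictly whenever the image moves. Equal heights at the two ends thus keep the image
    constant. *)
Lemma descent_chain phi s u q :
  (forall l m : 'cV[int]_n, phi (l + m) = phi l + phi m) ->
  (forall b, pos b -> 0 < phi (crt b) :> int) ->
  omega R pos s -> bruhat_chain T u q -> minuscule D (s ** last u q).1 ->
  [/\ minuscule D (s ** u).1, phi (s ** last u q).1 <= phi (s ** u).1 &
    phi (s ** last u q).1 = phi (s ** u).1 ->
    forall v, v \in q -> (s ** v).1 = (s ** u).1].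
Proof.
move=> phiD phi0 os; elim: q u => [|v q IHq] u; first by split.
rewrite -[last u _]/(last v q); move=> [uv vq] ml;
  have [mv lev eqv] := IHq v vq ml.
have [mu step] := descent_edge os uv mv.
case: step => [E|[b pb E]]; split=> //; rewrite E ?(phiD _ (crt _)) //.
- by move=> /eqv H x; rewrite inE => /orP[/eqP->//|/H].
- by have := phi0 b pb; lia.
- by have := phi0 b pb; lia.
Qed.

(** If [d] were negative, right multiplication by [finrefl b] would shorten [tr lam ** wl] within
    its coset of [W]. *)
Lemma min_rep_pos lam wl b d : is_min_rep R pos lam wl -> pos b ->
  maps (tr lam ** wl) (b, 0) d -> cpos pos d.
Proof.
move=> [wwl [m [s [u [os wu wlE um]]] minm]] pb; rewrite wlE => bd.
have [e be] := automorphism_maps (aff_weyl_automorphism wu) (b, 0).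
have [d' ed] := automorphism_maps (omega_automorphism os) e.
have us : (s ** u).2 \in unitmx.
  by rewrite unitmx_mul (omega_automorphism os).1 (aff_weyl_automorphism wu).1.
rewrite (maps_fun us bd (mapsM be ed)) (omega_maps hpos os ed).
have wb : weyl D (finrefl b) by apply: generated_gen; exists b.
have wub : aff_weyl R pos (u ** arefl (b, 0)).
  by rewrite arefl0; apply: generatedM (weyl_aff_weyl wb).
have [k uk] := has_length_ex wub.
have pb0 : cpos pos ((b, 0) : aroot D) by rewrite /cpos pb.
have mk : (m <= k)%N.
  apply: (minm (wl ** finrefl b)); first exact: generatedM.
  exists s, (u ** arefl (b, 0)); split=> //.
  by rewrite !amulA wlE arefl0.
apply: contraT => npos_e.
have be' : maps (u ** arefl (b, 0)) (b, 0) (aopp e).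
  exact: mapsM (maps_arefl (b, 0)) (maps_opp be).
have km : (k < m)%N = cpos pos (aopp e).
  apply: (has_length_lt hpos (@subset_refl _ T) pb0 be' uk).
  by rewrite -amulA arefl2 amulg1.
by move: km; rewrite cpos_opp // npos_e ltnNge mk.
Qed.

Lemma weyl_fst g : weyl D g -> g.1 = 0.
Proof.
move=> [s sW <-]; elim: s sW => //= x s IHs sW.
have [a ->] := sW x (mem_head _ _).
rewrite IHs => [|y ys]; first by rewrite mulmx0 addr0.
by apply: sW; rewrite inE ys orbT.
Qed.

Lemma weyl_arefl c : weyl D (arefl c) -> c.2 = 0.
Proof.
move=> /weyl_fst/= /(congr1 (pairing (rt c.1))).
by rewrite pairingZr rt_crt /pairing mulmx0 mxE; lia.
Qed.

End Descent.

(** * Comparison of the two Bruhat graphs *)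

Section Transport.
Variable n : nat.
Implicit Types (g h u v z : aff n).

Lemma edges_mull z p : z.2 \in unitmx -> (forall g, g \in p ->
  g.2 \in unitmx) ->
  edges (map (amul z) p) = edges p.
Proof.
move=> uz; case: p => //= u q; elim: q u => //= v q IHq u up.
have uu : u.2 \in unitmx by apply: up; rewrite mem_head.
rewrite ainvM // -amulA amulKg // IHq // => g gq.
by apply: up; rewrite inE gq orbT.
Qed.

Lemma transport_mull z u q : (forall g, g \in u :: q -> g.2 \in unitmx) ->
  transport (z ** u) (u :: q) = map (amul z) (u :: q).
Proof.
rewrite /transport /= => uq; congr (_ :: _).
elim: q u uq => //= v q IHq u uq.
have uu : u.2 \in unitmx by apply: uq; rewrite mem_head.
rewrite -amulA amulKVg // IHq // => g gq.
by apply: uq; rewrite inE gq orbT.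
Qed.

End Transport.

(** * Paths under left multiplication by the inverse of [t_lambda w_lambda] *)

Section Correspondence.
Variables (R : realType) (n : nat) (D : root_datum n) (pos : pred D).
Hypothesis hpos : positive_system pos.
Variables (lam : 'cV[int]_n) (wl s : aff n).
Hypothesis hwl : is_min_rep R pos lam wl.
Hypothesis os : omega R pos s.
Implicit Types (g h u v : aff n).

Local Notation T := (aff_simple_refl R pos).
Local Notation S := (simple_refl pos).

(** [s] undoes the shift of affine paths into [W_aff]; then the inverse of [t_lambda w_lambda] is
    applied. *)
Let z : aff n := ainv wl ** (ainv (tr lam) ** s).

Lemma shift_unit : z.2 \in unitmx.
Proof.
have [uwl _] := weylV hpos hwl.1; have [us _] := omega_automorphism os.
by rewrite !unitmx_mul !unitmx_inv uwl unitmx1.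
Qed.

Lemma shiftK v : tr lam ** wl ** (z ** v) = s ** v.
Proof.
have [uwl _] := weylV hpos hwl.1.
rewrite /z !amulA -[tr lam ** wl ** ainv wl]amulA amulgV // amulg1.
by rewrite amulgV ?unitmx1 // amul1g.
Qed.

Lemma shift_weyl v : aff_weyl R pos v -> (s ** v).1 = lam -> weyl D (z ** v).
Proof.
move=> wv vlam; have [_ wwl] := weylV hpos hwl.1.
rewrite /z -!amulA; apply: generatedM => //.
have [l [w [ww sE]]] := os.1.
(* Right multiplication by affine reflections stays in the extended Weyl group, so [s ** v] has the
   form [tr l' ** w']; the image of the origin then gives [l' = lam]. *)
have wv2 : exists l' w', weyl D w' /\ s ** v = tr l' ** w'.
  move: wv => [q qT <-] {v vlam}.
  elim/last_ind: q qT => [|q x IHq] qT; first by exists l, w; rewrite amulg1.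
  have [|l' [w' [ww' E]]] := IHq.
    by move=> y yq; apply: qT; rewrite mem_rcons inE yq orbT.
  have [c _ xE] : T x by apply: qT; rewrite mem_rcons mem_head.
  exists (l' - c.2 *: (w'.2 *m crt c.1)), (w' ** finrefl c.1); split.
    by apply: generatedM => //; apply: generated_gen; exists c.1.
  rewrite aprod_rcons amulA E xE /amul /arefl /finrefl /= !mul1mx (weyl_fst
    ww').
  by rewrite mulmx0 !addr0 -scalemxAr scaleNr.
have [l' [w' [ww' E]]] := wv2.
have -> : lam = l' by rewrite -vlam E /= (weyl_fst ww') mulmx0 addr0.
by rewrite E amulKg // unitmx1.
Qed.

(** [s ** v] factors as [tr lam ** wl] after [z ** v]. Here [s] preserves all signs, and
    [tr lam ** wl] preserves those of affine roots with constant term 0, by minimality; [f] is such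
    a root because [z ** v] is in [W]. *)
Lemma shift_root_sign v a e f : aff_weyl R pos v -> weyl D (z ** v) ->
  maps v (a, 0) e -> maps (z ** v) (a, 0) f -> cpos pos e = cpos pos f.
Proof.
move=> wv wzv ae af.
have [d ed] := automorphism_maps (omega_automorphism os) e.
rewrite -(omega_maps hpos os ed).
have autl : automorphism D (tr lam ** wl).
  by apply: automorphismM (automorphism_weyl hwl.1); exact: automorphism_tr.
have usv : (s ** v).2 \in unitmx.
  by rewrite unitmx_mul (omega_automorphism os).1 (aff_weyl_automorphism wv).1.
have fd : maps (tr lam ** wl) f d.
  have [d' fd'] := automorphism_maps autl f.
  have := mapsM af fd'; rewrite shiftK => /(maps_fun usv (mapsM ae ed)) dE.
  by rewrite dE.
have f0 : f.2 = 0.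
  by have [_ _ ->] := af; rewrite (weyl_fst wzv) /pairing mulmx0 mxE subr0.
have fE : (f.1, 0) = f by rewrite -f0; case: (f).
have [pf|npf] := boolP (pos f.1).
  rewrite (min_rep_pos hpos hwl pf (d := d)) ?fE //.
  by rewrite /cpos pf f0.
have pof : pos (ropp f.1) by rewrite (pos_opp hpos).
have := min_rep_pos hpos hwl pof (d := aopp d).
have -> : (ropp f.1, 0) = aopp f :> aroot D by rewrite /aopp f0 oppr0.
move=> /(_ (maps_opp fd)); rewrite cpos_opp // => /negPf->.
by rewrite /cpos (negPf npf) f0.
Qed.

(** Both edges carry the same reflection [arefl c], which lies in [W]. So [c] has constant term 0,
    and [shift_root_sign] matches the sign conditions of [bruhat_edgeP]. *)
Lemma shift_edge u v : aff_weyl R pos u -> weyl D (z ** u) -> weyl D (z ** v) ->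
  bruhat_edge T u v <-> bruhat_edge S (z ** u) (z ** v).
Proof.
move=> wu wzu wzv.
have ST : S `<=` T := simple_refl_aff R hpos.
have weylE := weyl_simple hpos.
have finE (c : aroot D) : weyl D (arefl c) -> (c.1, 0) = c.
  by move=> wc; rewrite -(weyl_arefl wc); case: (c).
split.
  move=> /(bruhat_edgeP hpos (@subset_refl _ T)).
  move=> [c [e [_ rc vE pos_c [ce pos_e]]]].
  have wc : weyl D (arefl c).
    have [uzu wzu'] := weylV hpos wzu.
    by rewrite -(amulKg (arefl c) uzu); apply: generatedM => //;
      rewrite -amulA -vE.
  have [f cf] := automorphism_maps (automorphism_weyl wzu) c.
  apply/(bruhat_edgeP hpos ST); exists c, f; split=> //.
  - by rewrite -weylE.
  - by rewrite -(finE c wc) arefl0; exact: finrefl_reflection.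
  - by rewrite vE amulA.
  - split=> //; rewrite -(finE c wc) in ce cf.
    by rewrite -(shift_root_sign wu wzu ce cf).
move=> /(bruhat_edgeP hpos ST) [c [f [_ rc vE pos_c [cf pos_f]]]].
have wc : weyl D (arefl c).
  by rewrite weylE; exact: (reflections_generated ST).
have [e ce] := automorphism_maps (aff_weyl_automorphism wu) c.
apply/(bruhat_edgeP hpos (@subset_refl _ T)); exists c, e; split=> //.
- exact: simple_reflections_aff.
- by rewrite -(amulKg v shift_unit) vE -amulA amulKg ?shift_unit.
- split=> //; rewrite -(finE c wc) in ce cf.
  by rewrite (shift_root_sign wu wzu ce cf).
Qed.

Lemma shift_chain u q : aff_weyl R pos u ->
  (forall v, v \in u :: q -> weyl D (z ** v)) -> bruhat_chain T u q ->
  bruhat_chain S (z ** u) (map (amul z) q).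
Proof.
elim: q u => //= v q IHq u wu wz [uv vq].
have wv := bruhat_edge_generated (@subset_refl _ T) uv.
split; first by apply/shift_edge => //; apply: wz; rewrite !inE eqxx ?orbT.
by apply: IHq => // x xq; apply: wz; rewrite inE xq orbT.
Qed.

(** Only the first vertex is assumed to land in [W]: edges of the finite graph keep the later ones
    there. *)
Lemma unshift_chain u q : aff_weyl R pos u -> weyl D (z ** u) ->
  bruhat_chain S (z ** u) (map (amul z) q) -> bruhat_chain T u q.
Proof.
elim: q u => // v q IHq u wu wzu [uv vq].
have wzv : weyl D (z ** v).
  have ST : S `<=` T := simple_refl_aff R hpos.
  by rewrite (weyl_simple hpos); exact: (bruhat_edge_generated ST uv).
have uv' : bruhat_edge T u v by apply/shift_edge.
have wv := bruhat_edge_generated (@subset_refl _ T) uv'.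
by split=> //; exact: IHq.
Qed.

End Correspondence.

(** * The bijection between the two sets of paths *)

Theorem proposition4p13
  (R : realType)
  (F : fieldType) (v : F -> int) (hF : local_field v)
  (n : nat) (D : root_datum n)
  (pos : pred D) (hpos : positive_system pos)
  (hZ : connected_center F D)
  (hder : simply_connected_derived D)
  (hstab : stabilizers_generated R v D)
  (mu : 'cV[int]_n) (hdom : dominant pos mu) (hmin : minuscule D mu)
  (lam : 'cV[int]_n) (wbar : aff n) (hwbar : weyl D wbar)
  (hadm : admissible R pos mu (tr lam ** wbar))
  (wl : aff n) (hwl : is_min_rep R pos lam wl)
  (prec : rel (aff n)) (hprec : reflection_ordering R pos prec) :
  let w := tr lam ** wbar in
  let S := simple_refl pos in
  let B_aff := aff_bruhat_paths R pos w (tr lam) in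
  let B_fin := bruhat_paths S (ainv wl ** wbar) (ainv wl) in
  let f := transport (ainv wl ** wbar) in
  set_bij B_aff B_fin f /\
  forall p, B_aff p ->
    [/\ edges (f p) = edges p,
        forall t, t \in edges p -> reflections S t &
        sorted prec (edges p) <->
        sorted (restrict_order S prec) (edges (f p))].
Proof.
move=> w S B_aff B_fin f.
have ST : S `<=` aff_simple_refl R pos := simple_refl_aff R hpos.
have [wbar_unit wwbar'] := weylV hpos hwbar.
have [wl_unit wwl'] := weylV hpos hwl.1.
have [phi [phiD phi0]] := height_exists hpos.
have w1 : w.1 = lam by rewrite /= (weyl_fst hwbar) mulmx0 addr0.
have w_unit : w.2 \in unitmx by rewrite unitmx_mul unitmx1.
(* Admissibility supplies the Omega-component [s] of [w] and a path from [ainv s ** w] to a shifted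
   [t_eta]. *)
have [_ [eta weta [s [u0 [x0 [os [wu0 wx0] wE etaE path_eta]]]]]] := hadm.
have s_unit := (omega_automorphism os).1.
have su0 : s ** u0 = w by [].
(* [t_eta] sends the origin to a minuscule cocharacter, and minuscularity descends along the path to
   [w]. *)
have lam_min : minuscule D lam.
  have [_ [q [_ _ uq last_q]]] := path_eta.
  have [|+ _ _] := descent_chain hpos phiD phi0 os uq.
    rewrite last_q -etaE.
    exact: minuscule_weyl (automorphism_weyl weta) hmin.
  by rewrite su0 w1.
have u0E : ainv s ** w = u0 by rewrite -su0 amulKg.
pose v0 := ainv s ** tr lam.
have sv0 : s ** v0 = tr lam by rewrite amulKVg.
(* [t_lambda] and [w] differ by an element of [W], hence share the component [s]. *)
have v0E : v0 = u0 ** ainv wbar by rewrite -u0E /w -!amulA amulgV // amulg1.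
have wv0 : aff_weyl R pos v0.
  by rewrite v0E; apply: generatedM => //; exact: weyl_aff_weyl.
pose z : aff n := ainv wl ** (ainv (tr lam) ** s).
have z_unit : z.2 \in unitmx := shift_unit hpos hwl os.
have zu0 : z ** u0 = ainv wl ** wbar.
  by rewrite /z -!amulA su0 /w amulKg // unitmx1.
have zv0 : z ** v0 = ainv wl by rewrite /z -!amulA sv0 amulVg ?unitmx1 ?amulg1.
(* Uniqueness of the Omega-component identifies the quantified [s'] of [aff_bruhat_paths] with
   [s]. *)
have B_affP p : B_aff p <-> exists q, [/\ p = u0 :: q,
    bruhat_chain (aff_simple_refl R pos) u0 q & last u0 q = v0].
  split=> [[s' [os' ws' _]]|[q [-> uq lq]]].
    have su : aff_weyl R pos (ainv s ** w) by rewrite u0E.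
    rewrite -(omega_uniq hpos w_unit os os' su ws').
    by rewrite u0E => -[q [-> _ uq lq]]; exists q.
  by exists s; split; rewrite ?u0E //; exists q; split=> //; rewrite lq.
have path_weyl q : bruhat_chain (aff_simple_refl R pos) u0 q ->
    last u0 q = v0 -> forall x, x \in u0 :: q ->
    aff_weyl R pos x /\ weyl D (z ** x).
  move=> uq lq.
  (* Both ends send the origin to [lam], so their heights agree and every vertex sends it there. *)
  have [|_ _] := descent_chain hpos phiD phi0 os uq; first by rewrite lq sv0.
  rewrite lq sv0 su0 w1 => /(_ erefl) const x xq.
  have wx := bruhat_chain_generated (@subset_refl _ _) wu0 uq xq.
  split=> //; apply: (shift_weyl hpos hwl os) => //.
  move: xq; rewrite inE => /orP[/eqP->|/const->//].
  by rewrite su0 w1.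
(* [f] starts at [z ** u0] and keeps the edges, so it multiplies all vertices on the left by [z]. *)
have fE q : bruhat_chain (aff_simple_refl R pos) u0 q -> last u0 q = v0 ->
    f (u0 :: q) = map (amul z) (u0 :: q).
  move=> uq lq; rewrite /f -zu0; apply: transport_mull => x xq.
  by have [/aff_weyl_automorphism[]] := path_weyl q uq lq x xq.
have f_chain q : bruhat_chain (aff_simple_refl R pos) u0 q -> last u0 q = v0 ->
    bruhat_chain S (z ** u0) (map (amul z) q).
  move=> uq lq; apply: (shift_chain hpos hwl os wu0) => // x xq.
  exact: (path_weyl q uq lq x xq).2.
have gen_zu0 : generated S (z ** u0).
  by rewrite -(weyl_simple hpos) zu0; exact: generatedM.
split; first split.
- move=> p /B_affP[q [-> uq lq]]; rewrite /B_fin fE //.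
  exists (map (amul z) q); rewrite -zu0; split=> //; first exact: f_chain.
  by rewrite last_map lq.
- move=> p p' /set_mem/B_affP[q [-> uq lq]] /set_mem/B_affP[q' [-> uq' lq']].
  rewrite !fE //; apply: inj_map => g h gh.
  by rewrite -(amulKg g z_unit) gh amulKg.
- move=> p [q [-> _ uq lq]].
  (* The preimage is the given path multiplied by [ainv z]. *)
  pose q' := map (amul (ainv z)) q.
  have qE : q = map (amul z) q'.
    rewrite -map_comp -[LHS]map_id; apply: eq_map => x /=.
    by rewrite amulKVg.
  have uq' : bruhat_chain (aff_simple_refl R pos) u0 q'.
    apply: (unshift_chain hpos hwl os wu0);
      first by rewrite -/z (weyl_simple hpos).
    by rewrite -/z -qE zu0.
  have lq' : last u0 q' = v0.
    rewrite -(amulKg v0 z_unit) zv0 -lq -zu0 -{1}(amulKg u0 z_unit).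
    by rewrite last_map.
  exists (u0 :: q'); first by apply/B_affP; exists q'.
  by rewrite fE //= -qE zu0.
move=> p /B_affP[q [-> uq lq]].
have edgesE : edges (f (u0 :: q)) = edges (u0 :: q).
  rewrite fE // edges_mull // => x xq.
  by have [/aff_weyl_automorphism[]] := path_weyl q uq lq x xq.
have reflE t : t \in edges (u0 :: q) -> reflections S t.
  rewrite -edgesE fE //; apply: (bruhat_chain_edges ST gen_zu0).
  exact: f_chain.
split=> //; rewrite edgesE.
(* All edges are reflections of [W], on which the restricted order agrees with [prec]. *)
have -> // : sorted prec (edges (u0 :: q)) =
  sorted (restrict_order S prec) (edges (u0 :: q)).
apply: (@eq_in_sorted _ (mem (edges (u0 :: q)))) (allss _) => t t' te te'.
by rewrite /restrict_order (mem_set (reflE t te)) (mem_set (reflE t' te')).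
Qed.
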